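(* Let $\Omega\subsetneq\mathbb C$ be a domain. For every $0<\alpha<e^{-1/2}$ there exists a constant $C_\alpha>0$ (depending only on $\alpha$) such that $\lambda_1(\Omega)\le C_\alpha\,\mathscr R_{L,\alpha}(\Omega)^{-2}$.
   Context: $\lambda_1(\Omega):=\inf\{\int_\Omega|\nabla\phi|^2/\int_\Omega|\phi|^2:\phi\in C_0^\infty(\Omega)\setminus\{0\}\}$ is the first Dirichlet eigenvalue of $-\Delta$. With $\Delta(z,s)=\{\zeta:|\zeta-z|<s\}$ and $\mathcal C_l$ the logarithmic capacity, $\mathscr R_{L,\alpha}(\Omega):=\sup\{r>0:\text{there is } z\in\Omega \text{ with } \mathcal C_l(\overline{\Delta(z,s)}\setminus\Omega)\le\alpha s\text{ for all }s\in(0,r)\}$. *)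

(* Defs.v *)
From HB Require Import structures.
From mathcomp Require Import all_boot all_order all_algebra.
From mathcomp Require Import all_classical all_reals all_analysis.
Set Implicit Arguments. Unset Strict Implicit. Unset Printing Implicit Defensive.
Import Order.TTheory GRing.Theory Num.Theory.
Import numFieldNormedType.Exports.
Local Open Scope classical_set_scope.
Local Open Scope ring_scope.

(* The complex plane C is modelled as R * R (z = (Re z, Im z)), with the
   product topology and the product (Borel) sigma-algebra. *)
Section Defs.
Variable R : realType.
Local Notation Pl := (R * R)%type.

Definition cdist (z w : Pl) : R :=
  Num.sqrt ((z.1 - w.1) ^+ 2 + (z.2 - w.2) ^+ 2).

Definition odisc (z : Pl) (s : R) : set Pl := [set w | cdist w z < s].

Definition pd1 (f : Pl -> R) : Pl -> R :=
  fun x => derive1 (fun t : R => f (t, x.2)) x.1.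
Definition pd2 (f : Pl -> R) : Pl -> R :=
  fun x => derive1 (fun t : R => f (x.1, t)) x.2.

Fixpoint Ck (k : nat) (f : Pl -> R) : Prop :=
  match k with
  | 0 => continuous f
  | k.+1 => continuous f /\
      (forall x : Pl, derivable (fun t : R => f (t, x.2)) x.1 1 /\
                      derivable (fun t : R => f (x.1, t)) x.2 1) /\
      Ck k (pd1 f) /\ Ck k (pd2 f)
  end.

Definition smooth (f : Pl -> R) : Prop := forall k, Ck k f.

(* phi in C_0^infty(Omega), phi complex valued: phi = (Re phi, Im phi) *)
Definition test_fun (O : set Pl) (phi : Pl -> R * R) : Prop :=
  smooth (fun x => (phi x).1) /\ smooth (fun x => (phi x).2) /\
  compact (closure [set x | phi x <> (0, 0)]) /\
  closure [set x | phi x <> (0, 0)] `<=` O.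

Definition leb2 := (@lebesgue_measure R \x @lebesgue_measure R)%E.

Definition grad_sq (phi : Pl -> R * R) (x : Pl) : R :=
  (pd1 (fun y => (phi y).1) x) ^+ 2 + (pd2 (fun y => (phi y).1) x) ^+ 2 +
  (pd1 (fun y => (phi y).2) x) ^+ 2 + (pd2 (fun y => (phi y).2) x) ^+ 2.
Definition abs_sq (phi : Pl -> R * R) (x : Pl) : R :=
  (phi x).1 ^+ 2 + (phi x).2 ^+ 2.

Definition rayleigh (O : set Pl) (phi : Pl -> R * R) : R :=
  Rintegral leb2 O (grad_sq phi) / Rintegral leb2 O (abs_sq phi).

Definition lambda1 (O : set Pl) : \bar R :=
  ereal_inf [set (rayleigh O phi)%:E | phi in
    [set phi | test_fun O phi /\ exists x, phi x <> (0, 0)]].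

Definition log_kernel (z w : Pl) : \bar R :=
  if z == w then +oo%E else (- ln (cdist z w))%:E.

Definition log_energy (mu : probability Pl R) : \bar R :=
  (\int[mu]_z (\int[mu]_w log_kernel z w))%E.

Definition robin (K : set Pl) : \bar R :=
  ereal_inf [set log_energy mu | mu in [set mu : probability Pl R | mu (~` K) = 0%E]].

(* logarithmic capacity C_l(K) = exp(-V(K))  (= 0 when V(K) = +oo) *)
Definition log_cap (K : set Pl) : \bar R := expeR (- robin K)%E.

Definition RL (O : set Pl) (a : R) : \bar R :=
  ereal_sup [set r%:E | r in [set r : R | 0 < r /\
     exists z, O z /\ forall s : R, 0 < s < r ->
       (log_cap (closure (odisc z s) `\` O) <= (a * s)%:E)%E]].

End Defs.

(* Main.v *)
(** Let [K] be the part of the closed disc [D] of centre [z] and radius [s]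
    lying outside the domain, and let [L = - ln a > 1/2], so that the Robin
    constant of [K] is at least [L - ln s].  The test function is a cutoff of a
    smoothed positive part of [u = L' - ln s - p], where [L'] is slightly less
    than [L] and [p] is a logarithmic potential exceeding [L' - ln s] on [K].

    - Existence of [p]: regularise the kernel to [- ln (|x - y|^2 + e^2) / 2] and
      minimise the energy, up to a small error, over finitely supported
      probability measures on [K].  Moving mass to a point of [K] cannot decrease
      the energy much, so the potential is almost at least the minimal energy on
      [K].  For small [e] this minimal energy is almost at least the Robin
      constant: otherwise measures of small energy would have a weak limit, a
      probability measure on [K] of too small logarithmic energy.
    - Energy: [u] is subharmonic, hence so is the smoothed positive part [W], and
      [int |grad (chi W)|^2 <= int W^2 |grad chi|^2], which is bounded because [W]
      is bounded on [D].
    - Mass: the mean of [ln (s / |x - y|)] over a disc of radius [s] is at most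
      [1/2], so the mean of [u] over [D] is at least about [L - 1/2 > 0]. *)

(* The capacity condition is used at one radius at a time: each admissible s gives lambda_1 <= C /
   s^2, and s then increases to the supremum. The test function must have compact support in an open
   set whose boundary may be arbitrarily bad, so u has to be negative at every point of K, not
   merely outside a polar set as with an equilibrium potential. Almost minimising a regularised
   energy gives an inequality at every point, at the price of a little of the slack between L and
   1/2. The regularised kernel is finite on the diagonal, so point masses can be used in the first
   variation, potentials are finite sums of explicit smooth functions, and subharmonicity is a
   pointwise computation. Returning to the true kernel needs compactness of the probability measures
   on K: the weak limit is built as the law of a K-valued map on [0, 1[, from limits of the masses
   of dyadic cells along an ultrafilter. The bound 1/2 on the mean of ln (s / |x - y|) is uniform in
   the pole y, so the way the measure is spread over K has no influence on the constant. *)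
Require Import Defs.
From HB Require Import structures.
From mathcomp Require Import all_boot all_order all_algebra.
From mathcomp Require Import all_classical all_reals all_analysis.
From mathcomp Require Import measurable_realfun.
From mathcomp Require Import ring lra.
Import Order.TTheory GRing.Theory Num.Theory.
Import numFieldNormedType.Exports.
Local Open Scope classical_set_scope.
Local Open Scope ring_scope.

(** * Smooth functions on the plane *)

Section Smooth.
Context {R : realType}.
Local Notation Pl := (R * R)%type.
Implicit Types (f g : Pl -> R).

(** [pd1] and [pd2] are total and say nothing about differentiability. Carrying existence and value
    together lets the rules of calculus be chained on explicit formulas and read off at the end by
    [has_pdE]. *)
Definition has_pd f (fx fy : Pl -> R) := forall x : Pl,
  is_derive x.1 1 (fun t : R => f (t, x.2)) (fx x) /\
  is_derive x.2 1 (fun t : R => f (x.1, t)) (fy x).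

Lemma has_pdE f fx fy : has_pd f fx fy -> pd1 f = fx /\ pd2 f = fy.
Proof.
move=> H; split; apply/funext => x; have [H1 H2] := H x.
- by rewrite /pd1 derive1E; apply: derive_val.
- by rewrite /pd2 derive1E; apply: derive_val.
Qed.

Lemma has_pd_ext {f fx fy} gx gy : has_pd f fx fy ->
  fx =1 gx -> fy =1 gy -> has_pd f gx gy.
Proof. by move=> H /funext <- /funext <-. Qed.

Lemma has_pd_cst (c : R) : has_pd (fun=> c) (fun=> 0) (fun=> 0).
Proof. by move=> x; split; exact: is_derive_cst. Qed.

Lemma has_pd_fst : has_pd (fst : Pl -> R) (fun=> 1) (fun=> 0).
Proof. by move=> x; split => /=; [exact: is_derive_id|exact: is_derive_cst]. Qed.

Lemma has_pd_snd : has_pd (snd : Pl -> R) (fun=> 0) (fun=> 1).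
Proof. by move=> x; split => /=; [exact: is_derive_cst|exact: is_derive_id]. Qed.

Lemma has_pdD f fx fy g gx gy : has_pd f fx fy -> has_pd g gx gy ->
  has_pd (fun x => f x + g x) (fun x => fx x + gx x) (fun x => fy x + gy x).
Proof.
by move=> Hf Hg x; have [f1 f2] := Hf x; have [g1 g2] := Hg x; split;
  apply: is_deriveD.
Qed.

Lemma has_pdM f fx fy g gx gy : has_pd f fx fy -> has_pd g gx gy ->
  has_pd (fun x => f x * g x) (fun x => f x * gx x + fx x * g x)
    (fun x => f x * gy x + fy x * g x).
Proof.
move=> Hf Hg [a b]; have [/= f1 f2] := Hf (a, b); have [/= g1 g2] := Hg (a, b).
split; apply: is_derive_eq; rewrite /GRing.scale/=; first by rewrite [_ * fx _]mulrC.
by rewrite [_ * fy _]mulrC.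
Qed.

Lemma has_pd_comp (h h' : R -> R) f fx fy : has_pd f fx fy ->
  (forall x, is_derive (f x) 1 h (h' (f x))) ->
  has_pd (fun x => h (f x)) (fun x => h' (f x) * fx x) (fun x => h' (f x) * fy x).
Proof.
move=> Hf Hh [a b]; have [/= f1 f2] := Hf (a, b); have H := Hh (a, b).
split.
- exact: (@is_derive1_comp R h (fun t => f (t, b)) a _ _ H f1).
- exact: (@is_derive1_comp R h (fun t => f (a, t)) b _ _ H f2).
Qed.

Lemma CkS k f fx fy : continuous f -> has_pd f fx fy -> Ck k fx -> Ck k fy ->
  Ck k.+1 f.
Proof.
move=> cf H c1 c2; have [e1 e2] := has_pdE f fx fy H.
split=> //; split; last by rewrite e1 e2.
by move=> x; have [h1 h2] := H x; split; apply: ex_derive.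
Qed.

Lemma CkS_pd k f : Ck k.+1 f -> has_pd f (pd1 f) (pd2 f).
Proof.
move=> [_ [H _]] x; have [h1 h2] := H x.
split.
- by rewrite /pd1 derive1E; exact (derivableP h1).
- by rewrite /pd2 derive1E; exact (derivableP h2).
Qed.

Lemma CkW k f : Ck k.+1 f -> Ck k f.
Proof.
elim: k f => [f [] //|k IH f H]; have [cf [_ [H1 H2]]] := H.
exact (CkS k f _ _ cf (CkS_pd _ _ H) (IH _ H1) (IH _ H2)).
Qed.

Lemma smooth_pd f : smooth f -> has_pd f (pd1 f) (pd2 f).
Proof. by move=> /(_ 1%N)/CkS_pd. Qed.

Lemma smooth_pd1 f : smooth f -> smooth (pd1 f).
Proof. by move=> H k; have [_ [_ []]] := H k.+1. Qed.

Lemma smooth_pd2 f : smooth f -> smooth (pd2 f).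
Proof. by move=> H k; have [_ [_ []]] := H k.+1. Qed.

Lemma smooth_continuous f : smooth f -> continuous f.
Proof. by move=> /(_ 0%N). Qed.

Lemma smooth_cst (c : R) : smooth (fun=> c).
Proof.
move=> k; elim: k c => [|k IH] c; first exact: cst_continuous.
apply: (CkS k _ _ _ _ (has_pd_cst c)); [exact: cst_continuous|exact: IH..].
Qed.

Lemma smooth_fst : smooth (fst : Pl -> R).
Proof.
have c : continuous (fst : Pl -> R) by move=> x; exact: cvg_fst.
by case=> [//|k]; apply: (CkS k _ _ _ c has_pd_fst); exact: smooth_cst.
Qed.

Lemma smooth_snd : smooth (snd : Pl -> R).
Proof.
have c : continuous (snd : Pl -> R) by move=> x; exact: cvg_snd.
by case=> [//|k]; apply: (CkS k _ _ _ c has_pd_snd); exact: smooth_cst.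
Qed.

Lemma CkD k f g : Ck k f -> Ck k g -> Ck k (fun x => f x + g x).
Proof.
elim: k f g => [f g cf cg x|k IH f g Hf Hg]; first exact: cvgD (cf x) (cg x).
have [cf [_ [f1 f2]]] := Hf; have [cg [_ [g1 g2]]] := Hg.
apply: (CkS k _ _ _ _ (has_pdD _ _ _ _ _ _ (CkS_pd _ _ Hf) (CkS_pd _ _ Hg))).
- by move=> x; exact: cvgD (cf x) (cg x).
- exact: IH.
- exact: IH.
Qed.

Lemma CkM k f g : Ck k f -> Ck k g -> Ck k (fun x => f x * g x).
Proof.
elim: k f g => [f g cf cg x|k IH f g Hf Hg]; first exact: cvgM (cf x) (cg x).
have [cf [_ [f1 f2]]] := Hf; have [cg [_ [g1 g2]]] := Hg.
apply: (CkS k _ _ _ _ (has_pdM _ _ _ _ _ _ (CkS_pd _ _ Hf) (CkS_pd _ _ Hg))).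
- by move=> x; exact: cvgM (cf x) (cg x).
- by apply: CkD; apply: IH => //; exact: CkW.
- by apply: CkD; apply: IH => //; exact: CkW.
Qed.

Lemma smoothD f g : smooth f -> smooth g -> smooth (fun x => f x + g x).
Proof. by move=> Hf Hg k; exact: CkD. Qed.

Lemma smoothM f g : smooth f -> smooth g -> smooth (fun x => f x * g x).
Proof. by move=> Hf Hg k; exact: CkM. Qed.

Lemma smoothN f : smooth f -> smooth (fun x => - f x).
Proof.
move=> Hf; have -> : (fun x => - f x) = (fun x => -1 * f x).
  by apply/funext => x; rewrite mulN1r.
by apply: smoothM => //; exact: smooth_cst.
Qed.

Lemma smoothB f g : smooth f -> smooth g -> smooth (fun x => f x - g x).
Proof. by move=> Hf Hg; apply: smoothD => //; exact: smoothN. Qed.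

Lemma smooth_sum (I : Type) (r : seq I) (F : I -> Pl -> R) :
  (forall i, smooth (F i)) -> smooth (fun x => \sum_(i <- r) F i x).
Proof.
move=> HF; elim: r => [|i r IH].
  have -> : (fun x => \sum_(i <- [::]) F i x) = (fun=> 0).
    by apply/funext => x; rewrite big_nil.
  exact: smooth_cst.
have -> : (fun x => \sum_(j <- i :: r) F j x) =
    (fun x => F i x + \sum_(j <- r) F j x).
  by apply/funext => x; rewrite big_cons.
exact: smoothD.
Qed.

Lemma continuous_comp_at (h : R -> R) f x : {for x, continuous f} ->
  derivable h (f x) 1 -> {for x, continuous (fun x => h (f x))}.
Proof.
move=> cf dh; apply: (@continuous_comp _ _ _ f h) => //.
by apply: differentiable_continuous; apply/derivable1_diffP.
Qed.

Lemma has_pdV (f fx fy : Pl -> R) : has_pd f fx fy -> (forall x, f x != 0) ->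
  has_pd (fun x => (f x)^-1) (fun x => - (f x) ^- 2 * fx x) (fun x => - (f x) ^- 2 * fy x).
Proof.
move=> Hf f0; apply: (has_pd_comp (fun y => y^-1) (fun y => - y ^- 2)) => // x.
apply: (is_derive_eq (@is_deriveV _ (fun y : R => y) (f x) 1 1 (f0 x) _)).
by rewrite /GRing.scale/= mulr1.
Qed.

Lemma smoothV f : smooth f -> (forall x, f x != 0) -> smooth (fun x => (f x)^-1).
Proof.
move=> Hf f0; elim=> [|k IH].
  by move=> x; apply: cvgV => //; exact: smooth_continuous.
have H := has_pdV _ _ _ (smooth_pd f Hf) f0.
apply: (CkS k _ _ _ _ H).
- by move=> x; apply: cvgV => //; exact: smooth_continuous.
- have -> : (fun x => - f x ^- 2 * pd1 f x) =
      (fun x => ((-1) * pd1 f x) * ((f x)^-1 * (f x)^-1)).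
    by apply/funext => x; field; exact: f0.
  by apply: CkM; apply: CkM => //; [exact: smooth_cst|exact: smooth_pd1].
- have -> : (fun x => - f x ^- 2 * pd2 f x) =
      (fun x => ((-1) * pd2 f x) * ((f x)^-1 * (f x)^-1)).
    by apply/funext => x; field; exact: f0.
  by apply: CkM; apply: CkM => //; [exact: smooth_cst|exact: smooth_pd2].
Qed.

Lemma has_pd_ln f fx fy : has_pd f fx fy -> (forall x, 0 < f x) ->
  has_pd (fun x => ln (f x)) (fun x => (f x)^-1 * fx x) (fun x => (f x)^-1 * fy x).
Proof.
move=> Hf f0; have H x : is_derive (f x) 1 (@ln R) (f x)^-1 by exact: is_derive1_ln.
exact (has_pd_comp (@ln R) (fun y => y^-1) f fx fy Hf H).
Qed.

Lemma smooth_ln f : smooth f -> (forall x, 0 < f x) -> smooth (fun x => ln (f x)).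
Proof.
move=> Hf f0.
have c : continuous (fun x => ln (f x)).
  move=> x; apply: continuous_comp_at; first exact: smooth_continuous.
  by have [] := is_derive1_ln (f0 x).
have Hi : smooth (fun x => (f x)^-1) by apply: smoothV => // x; rewrite gt_eqF.
move=> [//|k]; apply: (CkS k _ _ _ c (has_pd_ln _ _ _ (smooth_pd f Hf) f0)).
- by apply: CkM => //; exact: smooth_pd1.
- by apply: CkM => //; exact: smooth_pd2.
Qed.

(** The derivative is a witness rather than [derive1 h], so closed formulas such as those for [gexp]
    can be supplied directly. *)
Fixpoint Ck1 (k : nat) (h : R -> R) : Prop :=
  if k is k.+1 then exists h' : R -> R, (forall x : R, is_derive x 1 h (h' x)) /\ Ck1 k h'
  else continuous h.

Lemma Ck_comp k h f : Ck1 k h -> Ck k f -> Ck k (fun x => h (f x)).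
Proof.
elim: k h f => [h f ch cf x|k IH h f Hh Hf].
  by apply: (@continuous_comp _ _ _ f h); [exact: cf|exact: ch].
have [h' [Hh' Ch']] := Hh; have [cf [_ [f1 f2]]] := Hf.
apply: (CkS k _ _ _ _ (has_pd_comp h h' _ _ _ (CkS_pd _ _ Hf) _)) => //.
- by move=> x; apply: continuous_comp_at; [exact: cf|apply: ex_derive; exact: Hh'].
- by apply: CkM => //; apply: IH => //; exact: CkW.
- by apply: CkM => //; apply: IH => //; exact: CkW.
Qed.

Lemma Ck1D k (g h : R -> R) : Ck1 k g -> Ck1 k h -> Ck1 k (fun x => g x + h x).
Proof.
elim: k g h => [g h cg ch x|k IH g h [g' [G1 G2]] [h' [H1 H2]]].
  exact: cvgD (cg x) (ch x).
exists (fun x => g' x + h' x); split; last exact: IH.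
by move=> x; apply: is_deriveD.
Qed.

Lemma Ck1Z k (c : R) h : Ck1 k h -> Ck1 k (fun x => c * h x).
Proof.
elim: k h => [h ch x|k IH h [h' [H1 H2]]].
  by apply: cvgM; [exact: cvg_cst|exact: ch].
exists (fun x => c * h' x); split; last exact: IH.
by move=> x; apply: is_deriveZ.
Qed.

Lemma smooth_comp h f : (forall k, Ck1 k h) -> smooth f -> smooth (fun x => h (f x)).
Proof. by move=> Hh Hf k; apply: Ck_comp. Qed.

End Smooth.

(** * Flat functions *)

Section Bump.
Context {R : realType}.
Implicit Types x y t : R.

(** The classical flat function exp (-1/x), times powers of 1/x. The span of this family is closed
    under differentiation, so one induction gives smoothness of all its members. *)
Definition gexp (n : nat) (x : R) : R :=
  if 0 < x then x^-1 ^+ n * expR (- x^-1) else 0.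

Lemma gexp0 n x : x <= 0 -> gexp n x = 0.
Proof. by rewrite /gexp ltNge => ->. Qed.

Lemma gexpE n x : 0 < x -> gexp n x = x^-1 ^+ n * expR (- x^-1).
Proof. by rewrite /gexp => ->. Qed.

Lemma gexp_ge0 n x : 0 <= gexp n x.
Proof.
rewrite /gexp; case: ifP => // x0.
by rewrite mulr_ge0 ?expR_ge0// exprn_ge0// invr_ge0 ltW.
Qed.

Lemma expn_expRN_le n y : 0 <= y -> y ^+ n.+1 * expR (- y) <= n.+1`!%:R.
Proof.
move=> y0; have := expR_ge1Dxn n y0.
have fp : 0 < n.+1`!%:R :> R by rewrite ltr0n fact_gt0.
rewrite expRN ler_pdivrMr ?expR_gt0// => h.
rewrite mulrC -ler_pdivrMr//; apply: le_trans h.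
by rewrite lerDr.
Qed.

(** Put y = 1/x in y^(n+2) exp (-y) <= (n+2)!. Vanishing to second order is what makes the
    difference quotient at 0 tend to 0. *)
Lemma gexp_le n x : gexp n x <= n.+2`!%:R * x ^+ 2.
Proof.
rewrite /gexp; case: ifP => x0; last by rewrite mulr_ge0// sqr_ge0.
have := @expn_expRN_le n.+1 x^-1; rewrite invr_ge0 => /(_ (ltW x0)) H.
rewrite -ler_pdivrMr ?exprn_gt0//; apply: le_trans H.
by rewrite -exprVn [in leRHS]exprS [in leRHS]exprS expr2 le_eqVlt; apply/orP; left; apply/eqP; ring.
Qed.

Lemma is_derive_gexp n x : is_derive x 1 (gexp n) (- n%:R * gexp n.+1 x + gexp n.+2 x).
Proof.
have [x0|x0|->] := ltgtP x 0.
- rewrite !gexp0 ?ltW// mulr0 addr0.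
  apply: (@near_eq_is_derive _ _ _ (cst 0)).
  near=> y; rewrite /cst gexp0//; apply: ltW; near: y; exact: lt_nbhsl.
- pose H (v : R) : R := v ^+ n * expR (- v).
  have HH (v : R) : is_derive v 1 H ((n%:R * v ^+ n.-1 - v ^+ n) * expR (- v)).
    have hX : is_derive v 1 (fun v : R => v ^+ n) (n%:R * v ^+ n.-1).
      apply: DeriveDef; first exact: exprn_derivable.
      by rewrite exp_derive /GRing.scale/= mulr1.
    have hE : is_derive v 1 (fun v : R => expR (- v)) (expR (- v) * - 1).
      exact: (@is_derive1_comp R expR (fun v => - v) v _ _ _ _).
    rewrite /H; apply: (is_derive_eq (is_deriveM hX hE)).
    by rewrite /GRing.scale/=; ring.
  have dV : is_derive x 1 (fun y : R => y^-1) (- (x^-1 ^+ 2)).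
    have x0' : x != 0 by rewrite gt_eqF.
    apply: (is_derive_eq (@is_deriveV _ (fun y : R => y) x 1 1 x0' _)).
    by rewrite /GRing.scale/= mulr1 exprVn.
  have HC := @is_derive1_comp R H (fun y => y^-1) x _ _ (HH x^-1) dV.
  have HG : is_derive x 1 (gexp n) ((n%:R * x^-1 ^+ n.-1 - x^-1 ^+ n) *
      expR (- x^-1) * (- (x^-1 ^+ 2))).
    apply: (near_eq_is_derive _ HC).
    near=> y; rewrite /H /= gexpE//; near: y; exact: lt_nbhsr.
  apply: (is_derive_eq HG).
  rewrite !gexpE// !exprS; case: n {H HH HC HG} => [|n]; first by rewrite /= !expr0; ring.
  by rewrite /= !exprS; ring.
- rewrite !gexp0// mulr0 addr0.
  have C : (fun h : R => h^-1 *: ((gexp n \o shift 0) (h *: 1) - gexp n 0)) @ 0^' --> (0 : R).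
    apply/cvgr0Pnorm_lt => e e0; near=> h.
    have h0 : h != 0 by near: h; exact: nbhs_dnbhs_neq.
    rewrite /= addr0 /GRing.scale/= mulr1 (@gexp0 n 0)// subr0 normrM.
    have fp : 0 < n.+2`!%:R :> R by rewrite ltr0n fact_gt0.
    apply: (@le_lt_trans _ _ (n.+2`!%:R * `|h|)).
      rewrite (ger0_norm (gexp_ge0 _ _)) normfV mulrC ler_pdivrMr ?normr_gt0//.
      by apply: (le_trans (gexp_le _ _)); rewrite -mulrA -expr2 real_normK// num_real.
    rewrite mulrC -ltr_pdivlMr//; near: h; apply: dnbhs0_lt; exact: divr_gt0.
  apply: DeriveDef; [exact: (cvgP _ C)|exact: (cvg_lim _ C)].
Unshelve. all: by end_near. Qed.

Lemma Ck1_gexp k n : Ck1 k (gexp n).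
Proof.
elim: k n => [|k IH] n.
  move=> x; apply: differentiable_continuous; apply/derivable1_diffP.
  by have [] := is_derive_gexp n x.
exists (fun x => - n%:R * gexp n.+1 x + gexp n.+2 x); split.
  by move=> x; exact: is_derive_gexp.
by apply: Ck1D => //; exact: Ck1Z.
Qed.

(* A smoothed positive part; being convex and nondecreasing (its second
   derivative is [gexp 3]), it preserves subharmonicity. *)
Definition hconv (t : R) : R := t * gexp 0 t.

Lemma is_derive_hconv t : is_derive t 1 hconv (gexp 0 t + gexp 1 t).
Proof.
have H0 := is_derive_gexp 0 t.
apply: is_derive_eq; rewrite /GRing.scale/= mulr1 oppr0 mul0r add0r addrC; congr (_ + _).
have [t0|t0] := leP t 0; first by rewrite !gexp0// mulr0.
by rewrite !gexpE//; field; rewrite gt_eqF.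
Qed.

Lemma is_derive_hconv' t :
  is_derive t 1 (fun t => gexp 0 t + gexp 1 t) (gexp 3 t).
Proof.
have H0 := is_derive_gexp 0 t; have H1 := is_derive_gexp 1 t.
by apply: is_derive_eq; ring.
Qed.

Lemma Ck1_hconv k : Ck1 k hconv.
Proof.
case: k => [|k].
  move=> x; apply: differentiable_continuous; apply/derivable1_diffP.
  by have [] := is_derive_hconv x.
exists (fun x => gexp 0 x + gexp 1 x); split; first exact: is_derive_hconv.
by apply: Ck1D; exact: Ck1_gexp.
Qed.

Lemma hconv_ge0 t : 0 <= hconv t.
Proof.
rewrite /hconv; have [t0|t0] := leP t 0; first by rewrite gexp0// mulr0.
by rewrite mulr_ge0 ?gexp_ge0// ltW.
Qed.

Lemma hconv0 t : t <= 0 -> hconv t = 0.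
Proof. by move=> t0; rewrite /hconv gexp0// mulr0. Qed.

(** From exp y >= 1 + y at y = -1/t. The loss against the positive part is at most 1, hence at most
    eta after rescaling to eta * hconv (t / eta). *)
Lemma hconv_ge t : t - 1 <= hconv t.
Proof.
have [t0|t0] := leP t 0; first by rewrite hconv0//; lra.
rewrite /hconv gexpE// expr0 mul1r.
have := expR_ge1Dx (- t^-1) => h.
apply: (@le_trans _ _ (t * (1 + - t^-1))); last by rewrite ler_wpM2l// ltW.
by rewrite mulrDr mulr1 mulrN divff// gt_eqF.
Qed.

Lemma gexp0_le1 t : gexp 0 t <= 1.
Proof.
have [t0|t0] := leP t 0; first by rewrite gexp0.
by rewrite gexpE// expr0 mul1r expR_le1 oppr_le0 invr_ge0 ltW.
Qed.

Lemma hconv_le t M : 0 <= M -> t <= M -> hconv t <= M.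
Proof.
move=> M0 tM; have [t0|t0] := leP t 0; first by rewrite hconv0.
apply: le_trans tM; rewrite /hconv ler_piMr ?gexp0_le1//; exact: ltW.
Qed.

Lemma hconv'_le1 t : gexp 0 t + gexp 1 t <= 1.
Proof.
have [t0|t0] := leP t 0; first by rewrite !gexp0// addr0.
rewrite !gexpE// expr0 expr1 -mulrDl expRN ler_pdivrMr ?expR_gt0// mul1r.
exact: expR_ge1Dx.
Qed.

Lemma gexp2_le t : gexp 2 t <= 2.
Proof.
have [t0|t0] := leP t 0; first by rewrite !gexp0.
by rewrite gexpE//; apply: (@expn_expRN_le 1); rewrite invr_ge0 ltW.
Qed.

End Bump.

(** * Integration on the plane *)

Section PlaneIntegral.
Context {R : realType}.
Local Notation Pl := (R * R)%type.
Local Notation mu := (@lebesgue_measure R).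
Local Notation RM := (measurableTypeR R).
Local Notation leb2 := (@lebesgue_measure R \x @lebesgue_measure R)%E.

Definition box (p q : R) (e : R) : set Pl := ball p e `*` ball q e.

(** The bridge from the product topology to the product sigma-algebra: a countable union of rational
    boxes is measurable. *)
Lemma open_plane_bigcup_rat (U : set Pl) : open U ->
  U = \bigcup_(p : rat) \bigcup_(q : rat) \bigcup_(n : nat)
    (if `[< box (ratr p) (ratr q) n.+1%:R^-1 `<=` U >]
     then box (ratr p) (ratr q) n.+1%:R^-1 else set0).
Proof.
move=> oU; apply/seteqP; split; last first.
  by move=> x [p _ [q _ [n _]]]; case: asboolP => // H /H.
move=> [a b] Uab.
have /nbhs_ballP [e /= e0 He] : nbhs (a, b) U by exact: open_nbhs_nbhs.
have [n ne] : exists n : nat, n.+1%:R^-1 < e / 2.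
  have [n _ Hn] := near_infty_natSinv_lt (PosNum (divr_gt0 e0 (@ltr0n R 2))).
  by exists n; apply: (Hn n) => /=.
have n0 : 0 < n.+1%:R^-1 :> R by rewrite invr_gt0 ltr0n.
have n2 : n.+1%:R^-1 + n.+1%:R^-1 <= e.
  by move: n.+1%:R^-1 ne => d ne; lra.
have dr (c : R) : exists p : rat, ball c n.+1%:R^-1 (ratr p : R).
  have [y [Hp [p _ E]]] := @dense_rat R (ball c n.+1%:R^-1)
    (ex_intro _ c (ballxx c n0)) (ball_open c _).
  by exists p; rewrite E.
have [p Hp] := dr a; have [q Hq] := dr b.
exists p => //; exists q => //; exists n => //.
have H : box (ratr p) (ratr q) n.+1%:R^-1 `<=` U.
  move=> [c d] [/= H1 H2]; apply: He; split => /=.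
    apply: (@le_ball _ _ a (n.+1%:R^-1 + n.+1%:R^-1)) => //.
    exact: ball_triangle Hp H1.
  apply: (@le_ball _ _ b (n.+1%:R^-1 + n.+1%:R^-1)) => //.
  exact: ball_triangle Hq H2.
by case: asboolP => // _; split => /=; exact: ball_sym.
Qed.

Lemma open_plane_measurable (U : set Pl) : open U -> measurable (U : set (RM * RM)).
Proof.
move=> /open_plane_bigcup_rat ->.
apply: bigcupT_measurable_rat => p; apply: bigcupT_measurable_rat => q.
apply: bigcupT_measurable => n; case: asboolP => _; last exact: measurable0.
by apply: measurableX; apply: open_measurable; exact: ball_open.
Qed.

Lemma continuous_plane_measurable (f : Pl -> R) : continuous f ->
  measurable_fun (setT : set (RM * RM)) (f : RM * RM -> RM).
Proof.
move=> /continuousP cf; apply: (measurability _ (RGenOpens.measurableE R)).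
move=> _ [_ [a [b ->] <-]]; rewrite setTI; apply: open_plane_measurable.
exact/cf/interval_open.
Qed.

Definition square (M : R) : set Pl := `[- M, M] `*` `[- M, M].

Lemma square_compact M : compact (square M).
Proof. by apply: compact_setX; exact: segment_compact. Qed.

Lemma squareP M x : square M x <-> `|x.1| <= M /\ `|x.2| <= M.
Proof. by rewrite /square /= !in_itv/= !ler_norml. Qed.

Lemma measurable_square M : measurable (square M : set (RM * RM)).
Proof. by apply: measurableX; exact: measurable_itv. Qed.

Lemma leb2_square_lty M : (leb2 (square M) < +oo)%E.
Proof.
have H : (mu `[(- M)%R, M] < +oo)%E.
  by rewrite lebesgue_measure_itv/=; case: ifP => _; rewrite ?ltry// -EFinD ltry.
rewrite /square product_measure1E; [|exact: measurable_itv..].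
by rewrite lte_mul_pinfty// ge0_fin_numE.
Qed.

Lemma continuous_integrable_square (f : Pl -> R) M (A : set (RM * RM)) :
  continuous f -> measurable A ->
  A `<=` square M -> leb2.-integrable A (EFin \o f).
Proof.
move=> cf mA AM; apply: (integrableS (measurable_square M)) => //.
apply: measurable_bounded_integrable.
- exact: measurable_square.
- exact: leb2_square_lty.
- by apply: measurable_funTS; exact: continuous_plane_measurable.
- have cfM : {within square M, continuous f} by apply: continuous_subspaceT.
  have /compact_bounded[N [_ mrt]] := continuous_compact cfM (square_compact M).
  by exists N; split; rewrite ?num_real // => ? ? ? ?; exact: mrt.
Qed.

Lemma continuous_integrable_supp (f : Pl -> R) M : continuous f ->
  (forall x, ~ square M x -> f x = 0) -> leb2.-integrable setT (EFin \o f).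
Proof.
move=> cf f0; have -> : EFin \o f = ((EFin \o f) \_ (square M)).
  apply/funext => x; rewrite patchE; case: ifPn => //.
  by rewrite notin_setE => /f0 /= ->.
apply/(integrable_mkcond _ (measurable_square M)).
by apply: (@continuous_integrable_square _ M) => //; exact: measurable_square.
Qed.

Lemma integral_derive1_supp (g g' : R -> R) (M : R) : 0 <= M ->
  (forall x : R, is_derive x 1 g (g' x)) -> continuous g' ->
  (forall x, M < `|x| -> g x = 0) -> (forall x, M < `|x| -> g' x = 0) ->
  (\int[mu]_x (g' x)%:E = 0)%E.
Proof.
move=> M0 dg cg' g0 g'0.
(* The extra 1 puts both endpoints strictly beyond M, where g vanishes. *)
have -> : (\int[mu]_x (g' x)%:E = \int[mu]_(x in `[(- (M + 1))%R, (M + 1)%R]) (g' x)%:E)%E.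
  rewrite [RHS]integral_mkcond; apply: eq_integral => x _.
  rewrite patchE; case: ifPn => //; rewrite notin_setE /= in_itv/= -ler_norml => /negP.
  by rewrite -ltNge => Mx; rewrite g'0//; lra.
have cg x : {for x, continuous g}.
  by apply: differentiable_continuous; apply/derivable1_diffP; have [] := dg x.
rewrite (@continuous_FTC2 _ g' g).
- by rewrite !g0 ?subee// ?normrN ger0_norm; lra.
- by rewrite gtrN//; lra.
- exact: continuous_subspaceT.
- split.
  + by move=> x _; have [] := dg x.
  + by apply: cvg_at_right_filter; exact: cg.
  + by apply: cvg_at_left_filter; exact: cg.
- by move=> x _; rewrite derive1E; have [] := dg x.
Qed.

(** One component of the divergence theorem for compactly supported fields: by Fubini, every
    horizontal slice integrates to a difference of two zero endpoint values. *)
Lemma integral_pd1_supp (F Fx Fy : Pl -> R) M : 0 <= M -> has_pd F Fx Fy ->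
  continuous Fx -> (forall x, ~ square M x -> F x = 0 /\ Fx x = 0) ->
  Rintegral leb2 setT Fx = 0.
Proof.
move=> M0 HF cFx F0; rewrite /Rintegral -integral21_prod_meas1.
- rewrite integral0_eq// => y _; rewrite /fubini_G.
  have zero x : M < `|x| -> F (x, y) = 0 /\ Fx (x, y) = 0.
    by move=> Mx; apply: F0 => /squareP/= -[]; rewrite leNgt Mx.
  apply: (@integral_derive1_supp (fun x => F (x, y)) (fun x => Fx (x, y)) M) => //.
  + by move=> x; have [] := HF (x, y).
  + move=> x; apply: (@continuous_comp _ _ _ (fun x => (x, y)) Fx); last exact: cFx.
    by apply: (@cvg_pair _ _ _ _ (nbhs x) (nbhs y)); [exact: cvg_id|exact: cvg_cst].
  + by move=> x /zero[].
  + by move=> x /zero[].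
- by apply: (@continuous_integrable_supp _ M) => // x /F0[].
Qed.

Lemma integral_pd2_supp (F Fx Fy : Pl -> R) M : 0 <= M -> has_pd F Fx Fy ->
  continuous Fy -> (forall x, ~ square M x -> F x = 0 /\ Fy x = 0) ->
  Rintegral leb2 setT Fy = 0.
Proof.
move=> M0 HF cFy F0; rewrite /Rintegral -integral12_prod_meas1.
- rewrite integral0_eq// => x _; rewrite /fubini_F.
  have zero y : M < `|y| -> F (x, y) = 0 /\ Fy (x, y) = 0.
    by move=> My; apply: F0 => /squareP/= -[_]; rewrite leNgt My.
  apply: (@integral_derive1_supp (fun y => F (x, y)) (fun y => Fy (x, y)) M) => //.
  + by move=> y; have [] := HF (x, y).
  + move=> y; apply: (@continuous_comp _ _ _ (fun y => (x, y)) Fy); last exact: cFy.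
    by apply: (@cvg_pair _ _ _ _ (nbhs x) (nbhs y)); [exact: cvg_cst|exact: cvg_id].
  + by move=> y /zero[].
  + by move=> y /zero[].
- by apply: (@continuous_integrable_supp _ M) => // x /F0[].
Qed.

(** * Discs and their area *)

Lemma cdist_lt (z w : Pl) (s : R) : 0 < s ->
  (cdist w z < s) = ((w.1 - z.1) ^+ 2 + (w.2 - z.2) ^+ 2 < s ^+ 2).
Proof.
move=> s0; rewrite /cdist -[X in _ < X](ger0_norm (ltW s0)) -sqrtr_sqr ltr_sqrt//.
by rewrite exprn_gt0.
Qed.

Lemma cdist_continuous (z : Pl) : continuous (fun w => cdist w z).
Proof.
move=> w; apply: (@continuous_comp _ _ _
  (fun w : Pl => (w.1 - z.1) ^+ 2 + (w.2 - z.2) ^+ 2) Num.sqrt).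
  by apply: smooth_continuous; apply: smoothD; apply: smoothM;
    (apply: smoothB; [exact: smooth_fst || exact: smooth_snd|exact: smooth_cst]).
exact: sqrt_continuous.
Qed.

Lemma odisc_open (z : Pl) s : open (odisc z s).
Proof.
have /continuousP H := cdist_continuous z.
by have := H [set t | t < s]; apply; exact: open_lt.
Qed.

Lemma measurable_odisc (z : Pl) s : measurable (odisc z s : set (RM * RM)).
Proof. by apply: open_plane_measurable; exact: odisc_open. Qed.

Lemma odisc_square (z : Pl) (s : R) : 0 < s ->
  odisc z s `<=` square (`|z.1| + `|z.2| + s).
Proof.
move=> s0 w; rewrite /odisc /= cdist_lt// => h.
have sq (a b : R) : a ^+ 2 + b ^+ 2 < s ^+ 2 -> `|a| <= s.
  move=> H; rewrite -(ger0_norm (ltW s0)) -ler_sqr ?nnegrE// !real_normK ?num_real//.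
  by apply: le_trans (ltW H); rewrite lerDl sqr_ge0.
apply/squareP; split.
- have -> : w.1 = z.1 + (w.1 - z.1) by ring.
  apply: (le_trans (ler_normD _ _)); have := sq _ _ h; have := normr_ge0 z.2; lra.
- have -> : w.2 = z.2 + (w.2 - z.2) by ring.
  apply: (le_trans (ler_normD _ _)); rewrite addrC in h.
  by have := sq _ _ h; have := normr_ge0 z.1; lra.
Qed.

(** [Num.sqrt] is 0 on negative numbers, so this vanishes for |t| > 1 and areas can be integrated
    over the whole line. *)
Definition half_chord (t : R) : R := Num.sqrt (1 - t ^+ 2).

Lemma half_chord_continuous : continuous half_chord.
Proof.
move=> t; apply: (@continuous_comp _ _ _ (fun t : R => 1 - t ^+ 2) Num.sqrt).
  by apply: cvgB; [exact: cvg_cst|exact: exprn_continuous].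
exact: sqrt_continuous.
Qed.

(** This is pi. Area enters the Rayleigh quotient as a common factor of numerator and denominator,
    so it is kept as one positive finite constant. *)
Definition unit_disc_area : \bar R := (\int[mu]_t (2 * half_chord t)%:E)%E.

(** The slice at abscissa x is an interval of half-length s * [half_chord] ((x - z.1) / s); the
    substitution x = s t + z.1 brings out the factor s^2. *)
Lemma leb2_odisc (z : Pl) (s : R) : 0 < s ->
  (leb2 (odisc z s) = (s ^+ 2)%:E * unit_disc_area)%E.
Proof.
move=> s0; rewrite /product_measure1.
pose G (x : R) : R := 2 * s * half_chord ((x - z.1) / s).
have cG : continuous G.
  move=> x; apply: cvgM; first exact: cvg_cst.
  apply: (@continuous_comp _ _ _ (fun x => (x - z.1) / s) half_chord); last exact: half_chord_continuous.
  by apply: cvgM; [apply: cvgB; [exact: cvg_id|exact: cvg_cst]|exact: cvg_cst].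
have hc0 t : 0 <= half_chord t by exact: sqrtr_ge0.
have -> : (\int[mu]_x (mu \o xsection (odisc z s)) x = \int[mu]_x (G x)%:E)%E.
  apply: eq_integral => x _ /=.
  have -> : xsection (odisc z s) x = ball z.2 (s * half_chord ((x - z.1) / s)).
    apply/seteqP; split => y; rewrite xsectionP /odisc/= cdist_lt//= /ball/= distrC /half_chord.
    - move=> h.
      have p : 0 < 1 - ((x - z.1) / s) ^+ 2.
        rewrite subr_gt0 exprMn exprVn ltr_pdivrMr ?exprn_gt0// mul1r.
        by apply: le_lt_trans h; rewrite lerDl sqr_ge0.
      rewrite -[ltRHS]ger0_norm ?mulr_ge0 ?sqrtr_ge0 ?(ltW s0)//.
      rewrite -ltr_sqr ?nnegrE// !real_normK ?num_real// exprMn sqr_sqrtr ?(ltW p)//.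
      by rewrite mulrBr mulr1 exprMn exprVn mulrCA divff ?gt_eqF ?exprn_gt0// mulr1; lra.
    - move=> h; have [p|p] := ltP 0 (1 - ((x - z.1) / s) ^+ 2); last first.
        by move: h; rewrite ler0_sqrtr// mulr0 normr_lt0.
      move: h; rewrite -[ltRHS]ger0_norm ?mulr_ge0 ?sqrtr_ge0 ?(ltW s0)//.
      rewrite -ltr_sqr ?nnegrE// !real_normK ?num_real// exprMn sqr_sqrtr ?(ltW p)//.
      by rewrite mulrBr mulr1 exprMn exprVn mulrCA divff ?gt_eqF ?exprn_gt0// mulr1; lra.
  rewrite lebesgue_measure_ball; last by rewrite mulr_ge0// ltW.
  by congr EFin; rewrite /G; ring.
pose F (t : R) : R := s * t + z.1.
have dF (t : R) : is_derive t 1 F s.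
  by rewrite /F; apply: is_derive_eq; rewrite /GRing.scale/=; ring.
have F' : derive1 F = cst s.
  by apply/funext => t; rewrite derive1E; have [] := dF t.
rewrite (@increasing_ge0_integration_by_substitutionT R F G).
- rewrite -ge0_integralZl_EFin//.
  + apply: eq_integral => t _; rewrite F' -EFinM; congr EFin.
    have GF : G (F t) = 2 * s * half_chord t.
      by rewrite /G /F; congr (_ * half_chord _); field; rewrite gt_eqF.
    by transitivity (G (F t) * s) => //; rewrite GF; ring.
  + by move=> t _; rewrite lee_fin mulr_ge0.
  + apply/measurable_EFinP; apply: continuous_measurable_fun => t.
    by apply: cvgM; [exact: cvg_cst|exact: half_chord_continuous].
  + by rewrite exprn_ge0// ltW.
- by move=> x y xy; rewrite /F ltrD2r ltr_pM2l.
- by rewrite F'; exact: cst_continuous.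
- by rewrite F'; exact: is_cvg_cst.
- by rewrite F'; exact: is_cvg_cst.
- by move=> x; have [] := dF x.
- apply/cvgrNyPle => A; have := nbhs_ninfty_le (num_real ((A - z.1) / s)).
  by apply: filterS => t Ht; rewrite /F -lerBrDr mulrC -ler_pdivlMr.
- apply/cvgryPge => A; have := nbhs_pinfty_ge (num_real ((A - z.1) / s)).
  by apply: filterS => t Ht; rewrite /F -lerBlDr mulrC -ler_pdivrMr.
- exact: cG.
- by move=> x; rewrite /G mulr_ge0// mulr_ge0// ltW.
Qed.

Lemma unit_disc_area_fin : (0 < unit_disc_area < +oo)%E.
Proof.
have E : unit_disc_area = leb2 (odisc (0, 0) 1).
  by rewrite leb2_odisc// expr1n mul1e.
apply/andP; split; rewrite E.
- apply: (@lt_le_trans _ _ (leb2 (ball (0 : R) (1/2) `*` ball (0 : R) (1/2)))).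
    have hb : mu (ball (0 : R) (1/2)) = 1%:E.
      by rewrite lebesgue_measure_ball ?divr_ge0//; congr EFin; rewrite mulr2n; lra.
    rewrite product_measure1E; [|by apply: open_measurable; exact: ball_open..].
    by rewrite [X in (_ < X * X)%E]hb mule1 lte01.
  apply: le_measure; rewrite ?inE.
  + by apply: measurableX; apply: open_measurable; exact: ball_open.
  + exact: measurable_odisc.
  + move=> [x y] [/= ]; rewrite /ball/= !sub0r !normrN => hx hy.
    rewrite /odisc /= cdist_lt//= !subr0 expr1n.
    move: hx hy; rewrite !ltr_norml => /andP[h1 h2] /andP[h3 h4]; nra.
- apply: le_lt_trans (leb2_square_lty (`|0| + `|0| + 1)).
  apply: le_measure; rewrite ?inE; [exact: measurable_odisc|exact: measurable_square|].
  exact: (@odisc_square (0,0)).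
Qed.

End PlaneIntegral.

(** * The regularised logarithmic kernel *)

Section Kernel.
Context {R : realType}.
Local Notation Pl := (R * R)%type.
Implicit Types (z w x y : Pl) (e : R).

Definition sqd z w : R := (z.1 - w.1) ^+ 2 + (z.2 - w.2) ^+ 2.

(* Smooth, and increasing to [log_kernel] as [e] decreases to [0]. *)
Definition kap e z w : R := - ln (sqd z w + e ^+ 2) / 2.

Lemma sqd_ge0 z w : 0 <= sqd z w.
Proof. by rewrite addr_ge0// sqr_ge0. Qed.

Lemma sqdC z w : sqd z w = sqd w z.
Proof. by rewrite /sqd; congr (_ + _); ring. Qed.

Lemma kapC e z w : kap e z w = kap e w z.
Proof. by rewrite /kap sqdC. Qed.

Lemma sqd_gt0 e z w : 0 < e -> 0 < sqd z w + e ^+ 2.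
Proof. by move=> e0; rewrite ltr_wpDl ?sqd_ge0// exprn_gt0. Qed.

Lemma ln_sub_le (a b : R) : 0 < a -> 0 < b -> ln a - ln b <= (a - b) / b.
Proof.
move=> a0 b0; rewrite -ln_div ?posrE//.
have := @le_ln1Dx R (a / b - 1); have ab : 0 < a / b by rewrite divr_gt0.
rewrite (_ : 1 + (a / b - 1) = a / b); last ring.
have -> : (a - b) / b = a / b - 1 by rewrite mulrBl divff// gt_eqF.
by apply; lra.
Qed.

Lemma kap_mono (e e' : R) z w : 0 < e -> e <= e' -> kap e' z w <= kap e z w.
Proof.
move=> e0 ee; have e'0 := lt_le_trans e0 ee.
rewrite /kap ler_pM2r ?invr_gt0// lerN2 ler_ln ?posrE ?sqd_gt0// lerD2l.
by rewrite ler_sqr ?nnegrE// ltW.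
Qed.

Lemma kap_le (e : R) z w : 0 < e -> kap e z w <= - ln e.
Proof.
move=> e0; rewrite /kap.
have : ln (e ^+ 2) <= ln (sqd z w + e ^+ 2).
  by rewrite ler_ln ?posrE ?sqd_gt0 ?exprn_gt0// lerDr sqd_ge0.
by rewrite lnXn// mulr2n; lra.
Qed.

Lemma kap_ge (e B : R) z w : 0 < e -> sqd z w + e ^+ 2 <= B -> - ln B / 2 <= kap e z w.
Proof.
move=> e0 hB; rewrite /kap ler_pM2r ?invr_gt0// lerN2.
have sp := sqd_gt0 e z w e0.
by rewrite ler_ln ?posrE// (lt_le_trans sp).
Qed.

(** Each coordinate changes the squared distance by at most 2h * 4M, a difference of squares. The
    bound ln a - ln b <= (a - b) / b with b >= e^2 then gives 16 M h / e^2, and the kernel carries a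
    factor 1/2. *)
Lemma kap_modulus (e M h : R) x y x' y' : 0 < e -> 0 <= h ->
  `|x.1 - x'.1| <= h -> `|x.2 - x'.2| <= h ->
  `|y.1 - y'.1| <= h -> `|y.2 - y'.2| <= h ->
  `|x.1| <= M -> `|x.2| <= M -> `|y.1| <= M -> `|y.2| <= M ->
  `|x'.1| <= M -> `|x'.2| <= M -> `|y'.1| <= M -> `|y'.2| <= M ->
  kap e x y <= kap e x' y' + 8 * M * h / e ^+ 2.
Proof.
move=> e0 h0 a1 a2 b1 b2 x1 x2 y1 y2 x'1 x'2 y'1 y'2.
have sq (a b c d : R) : `|a - c| <= h -> `|b - d| <= h -> `|a| <= M -> `|b| <= M ->
    `|c| <= M -> `|d| <= M -> (c - d) ^+ 2 - (a - b) ^+ 2 <= 8 * M * h.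
  rewrite !ler_norml => /andP[q1 q2] /andP[q3 q4] /andP[q5 q6] /andP[q7 q8] /andP[q9 q10] /andP[q11 q12].
  have -> : (c - d) ^+ 2 - (a - b) ^+ 2 = ((c - a) + (b - d)) * ((c - d) + (a - b)) by ring.
  apply: (le_trans (ler_norm _)); rewrite normrM.
  have -> : 8 * M * h = (2 * h) * (4 * M) by ring.
  by apply: ler_pM => //; rewrite ler_norml; apply/andP; split; lra.
have S : sqd x' y' - sqd x y <= 16 * M * h.
  have := sq _ _ _ _ a1 b1 x1 y1 x'1 y'1; have := sq _ _ _ _ a2 b2 x2 y2 x'2 y'2.
  by rewrite /sqd; lra.
have M0 : 0 <= M by apply: le_trans x1.
have P := sqd_gt0 e x y e0; have P' := sqd_gt0 e x' y' e0.
have H := ln_sub_le _ _ P' P.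
have E2 : 0 < e ^+ 2 by rewrite exprn_gt0.
have : (sqd x' y' + e ^+ 2 - (sqd x y + e ^+ 2)) / (sqd x y + e ^+ 2) <= 16 * M * h / e ^+ 2.
  apply: (@le_trans _ _ (16 * M * h / (sqd x y + e ^+ 2))).
    by rewrite ler_pM2r ?invr_gt0//; lra.
  rewrite ler_wpM2l ?mulr_ge0// lef_pV2 ?posrE// lerDr sqd_ge0 //.
rewrite /kap.
have -> : 8 * M * h / e ^+ 2 = (16 * M * h / e ^+ 2) / 2 by field; rewrite gt_eqF.
by move: H; lra.
Qed.

Lemma cvg_kap_log_kernel (e : nat -> R) z w : (forall n, 0 < e n) ->
  e n @[n --> \oo] --> (0 : R) ->
  (kap (e n) z w)%:E @[n --> \oo] --> log_kernel z w.
Proof.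
move=> e0 ecvg; rewrite /log_kernel; case: eqP => [->|zw].
  apply/cvgeyPge => A; near=> n; rewrite lee_fin /kap /sqd !subrr expr0n/= !addr0 add0r lnXn//.
  suff : ln (e n) <= - A by rewrite mulr2n; lra.
  rewrite -(expRK (- A)) ler_ln ?posrE ?expR_gt0//.
  near: n; have /cvgr0Pnorm_le := ecvg; move=> /(_ _ (expR_gt0 (- A))).
  by apply: filterS => n; apply: le_trans; exact: ler_norm.
have s0 : 0 < sqd z w.
  rewrite lt_neqAle sqd_ge0 andbT eq_sym; apply/eqP => s0; apply: zw.
  have /eqP := s0; rewrite paddr_eq0 ?sqr_ge0// !sqrf_eq0 !subr_eq0 => /andP[/eqP h1 /eqP h2].
  by rewrite (surjective_pairing z) (surjective_pairing w) h1 h2.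
have -> : - ln (cdist z w) = - ln (sqd z w + 0 ^+ 2) / 2.
  rewrite expr0n/= addr0 /cdist -/(sqd z w).
  rewrite -{2}(sqr_sqrtr (ltW s0)) lnXn ?sqrtr_gt0// mulr2n; lra.
apply: cvg_EFin; first by near=> n.
rewrite /kap; apply: cvgM; last exact: cvg_cst.
apply: cvgN.
have Hc : (sqd z w + e n ^+ 2) @[n --> \oo] --> sqd z w + 0 ^+ 2.
  apply: cvgD; first exact: cvg_cst.
  exact: (cvgM ecvg ecvg).
apply: (@cvg_comp _ _ _ (fun n => sqd z w + e n ^+ 2) (@ln R) _ _ _ Hc).
by apply: continuous_ln; rewrite expr0n/= addr0.
Unshelve. all: by end_near. Qed.

End Kernel.

(** * Dyadic addresses of the points of a bounded set *)

Section Dyadic.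
Context {R : realType}.
Local Notation Pl := (R * R)%type.

(** For c t in [0, 1[, the integer written by the first k binary digits of c t, not its k-th digit
    alone. *)
Definition digit (c : R -> R) (k : nat) (t : R) : nat := Num.truncn (2 ^+ k * c t).

Lemma truncn_half (y : R) : 0 <= y -> Num.truncn y = (Num.truncn (2 * y) %/ 2)%N.
Proof.
move=> y0; have y2 : 0 <= 2 * y by rewrite mulr_ge0.
apply/eqP; rewrite truncn_eq//.
have /andP[h1 h2] := truncn_itv y2.
set N := Num.truncn _ in h1 h2 *.
apply/andP; split.
  have : ((N %/ 2 * 2)%N%:R <= N%:R :> R) by rewrite ler_nat leq_trunc_div.
  by rewrite natrM; lra.
have : (N.+1%:R <= ((N %/ 2).+1 * 2)%N%:R :> R).
  by rewrite ler_nat {1}(divn_eq N 2) mulSn addnC -addSn leq_add2r ltn_mod.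
by rewrite natrM; lra.
Qed.

(* [idx k x] interleaves the first [k] binary digits of the two coordinates. *)
Lemma dyadic_index (K : set Pl) (M : R) : 0 < M ->
  (forall x, K x -> `|x.1| <= M /\ `|x.2| <= M) ->
  exists idx : nat -> Pl -> nat, forall k,
    [/\ forall x, K x -> (idx k x < 4 ^ k)%N,
        forall x, K x -> idx k x = (idx k.+1 x %/ 4)%N &
        forall x y, K x -> K y -> idx k x = idx k y ->
          `|x.1 - y.1| <= 4 * M / 2 ^+ k /\ `|x.2 - y.2| <= 4 * M / 2 ^+ k].
Proof.
move=> M0 KM.
(* Dividing by 4M rather than 2M maps [-M, M] into [0, 1/2], so the endpoint M also stays below 1
   and has no digit before the binary point. *)
pose c (t : R) : R := (t + M) / (4 * M).
have M4 : 0 < 4 * M by rewrite mulr_gt0.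
have cP t : `|t| <= M -> 0 <= c t < 1.
  rewrite ler_norml => /andP[h1 h2]; apply/andP; split.
    by apply: divr_ge0; [lra|exact: ltW].
  by rewrite /c ltr_pdivrMr//; lra.
pose d := digit c.
have p2 k : 0 < 2 ^+ k :> R by rewrite exprn_gt0.
have dS k t : `|t| <= M -> d k.+1 t = (d k t * 2 + d k.+1 t %% 2)%N.
  move=> /cP/andP[c0 _].
  have q0 : 0 <= 2 ^+ k * c t by rewrite mulr_ge0// ltW.
  by rewrite /d /digit exprS -mulrA (truncn_half _ q0); exact: divn_eq.
have dclose : forall k (t u : R), `|t| <= M -> `|u| <= M -> d k t = d k u -> `|t - u| <= 4 * M / 2 ^+ k.
  move=> k t u /cP/andP[t0 _] /cP/andP[u0 _] E.
  have := @truncn_itv R (2 ^+ k * c t); rewrite mulr_ge0 ?(ltW (p2 k))// => /(_ isT)/andP[h1 h2].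
  have := @truncn_itv R (2 ^+ k * c u); rewrite mulr_ge0 ?(ltW (p2 k))// => /(_ isT)/andP[h3 h4].
  move: E h1 h2; rewrite /d /digit => -> h1 h2.
  have -> : t - u = 4 * M * (c t - c u) by rewrite /c; field; rewrite gt_eqF.
  rewrite normrM (gtr0_norm M4) ler_pM2l//.
  rewrite -[leRHS]mul1r ler_pdivlMr// -(gtr0_norm (p2 k)) -normrM mulrC mulrBr.
  by move: h1 h2 h3 h4; rewrite -natr1 ler_norml => *; apply/andP; split; lra.
pose idx := (fix idx (k : nat) (x : Pl) : nat := if k is k'.+1 then
  (idx k' x * 4 + ((d k x.1 %% 2) * 2 + d k x.2 %% 2))%N else 0%N).
have b3 a b : (a %% 2 * 2 + b %% 2 < 4)%N.
  by have := ltn_pmod a (isT : 0 < 2)%N; have := ltn_pmod b (isT : 0 < 2)%N;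
    case: (a %% 2)%N => [|[|]] //; case: (b %% 2)%N => [|[|]].
exists idx => k; split.
- move=> x _; elim: k => [//|k IH] /=; rewrite expnSr.
  apply: (@leq_trans ((idx k x).+1 * 4)); last by rewrite leq_mul2r.
  by rewrite mulSn addnC ltn_add2r.
- by move=> x _ /=; rewrite divnMDl// divn_small// addn0.
- move=> x y /KM[x1 x2] /KM[y1 y2] E.
  suff [E1 E2] : d k x.1 = d k y.1 /\ d k x.2 = d k y.2 by split; apply: dclose.
  elim: k E => [|k IH] /=.
    have z t : `|t| <= M -> d 0%N t = 0%N.
      by move=> /cP/andP[c0 c1]; rewrite /d /digit expr0 mul1r; apply/eqP; rewrite truncn_eq// c0.
    by move=> _; rewrite !z.
  move=> E.
  have E4 : idx k x = idx k y.
    by have /(congr1 (divn ^~ 4)) := E; rewrite !divnMDl// !divn_small ?addn0.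
  have [E1 E2] := IH E4.
  move: E; rewrite E4 => /addnI E.
  have F2 : (d k.+1 x.2 %% 2 = d k.+1 y.2 %% 2)%N.
    by have /(congr1 (modn ^~ 2)) := E; rewrite !modnMDl !modn_mod.
  have F1 : (d k.+1 x.1 %% 2 = d k.+1 y.1 %% 2)%N.
    by move: E; rewrite F2 => /addIn /eqP; rewrite eqn_mul2r => /eqP.
  by rewrite (dS k x.1)// (dS k y.1)// (dS k x.2)// (dS k y.2)// E1 E2 F1 F2.
Qed.

End Dyadic.

(** * Limits along an ultrafilter *)

Section UltraLimit.
Context {R : realType}.

(** For an ultrafilter a cluster point is a limit. A single ultrafilter thus serves all cell masses
    at once, in place of a diagonal subsequence. *)
Lemma ultra_limit01 (U : set_system nat) (u : nat -> R) : UltraFilter U ->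
  (forall n, 0 <= u n <= 1) -> exists l : R, u n @[n --> U] --> l.
Proof.
move=> UU u01; have PF : ProperFilter (u n @[n --> U]) by exact: fmap_proper_filter.
have /(_ (u n @[n --> U]) PF) := @segment_compact R 0 1.
case=> [|l [_ Hl]].
  have : U (u @^-1` `[0, 1]) by apply: filterE => n; rewrite /= in_itv/=; exact: u01.
  by [].
exists l => A Al; have [//|UA] := in_ultra_setVsetC (u @^-1` A) UU.
have [y [/= yA]] := Hl (~` A) A UA Al.
by move=> /yA.
Qed.

End UltraLimit.

(** * Weak limits of finitely supported measures *)

Section Atomic.
Context {R : realType}.
Local Notation Pl := (R * R)%type.

(* A finitely supported measure is a list of (weight, atom) pairs. *)
Definition aprob (K : set Pl) (s : seq (R * Pl)) :=
  (forall p, p \in s -> 0 <= p.1 /\ K p.2) /\ \sum_(p <- s) p.1 = 1.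

Definition aen (e : R) (s : seq (R * Pl)) : R :=
  \sum_(p <- s) \sum_(q <- s) p.1 * q.1 * kap e p.2 q.2.

Lemma aen_mono K (e e' : R) s : aprob K s -> 0 < e -> e <= e' -> aen e' s <= aen e s.
Proof.
move=> [sK _] e0 ee; rewrite /aen big_seq [leRHS]big_seq; apply: ler_sum => p ps.
rewrite big_seq [leRHS]big_seq; apply: ler_sum => q qs.
by rewrite ler_wpM2l ?kap_mono// mulr_ge0//; [have [] := sK _ ps|have [] := sK _ qs].
Qed.

End Atomic.

(** * The weak limit as the law of a quantile map *)

Section WeakLimit.
Context {R : realType}.
Local Notation Pl := (R * R)%type.
Local Notation mu := (@lebesgue_measure R).
Local Notation RM := (measurableTypeR R).
Context (K : set Pl) (M : R) (s : nat -> seq (R * Pl)) (idx : nat -> Pl -> nat)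
  (U : set_system nat) (G : nat -> nat -> R) (x0 : Pl).
Context {PU : ProperFilter U}.
Context (M0 : 0 < M) (KM : forall x, K x -> `|x.1| <= M /\ `|x.2| <= M)
  (clK : closed K) (Kx0 : K x0) (sK : forall n, aprob K (s n))
  (idxP : forall k,
    [/\ forall x, K x -> (idx k x < 4 ^ k)%N,
        forall x, K x -> idx k x = (idx k.+1 x %/ 4)%N &
        forall x y, K x -> K y -> idx k x = idx k y ->
          `|x.1 - y.1| <= 4 * M / 2 ^+ k /\ `|x.2 - y.2| <= 4 * M / 2 ^+ k]).

(** The distribution function of the n-th measure along the ordering of the level-k cells. Masses
    are cumulative so that their limits are directly the endpoints of the intervals [cell]. *)
Definition cmass n k j : R := \sum_(p <- s n | (idx k p.2 < j)%N) p.1.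

Context (Gcvg : forall k j, cmass n k j @[n --> U] --> G k j).

Lemma cmass_mono n k i j : (i <= j)%N -> cmass n k i <= cmass n k j.
Proof.
move=> ij; rewrite /cmass big_mkcond [leRHS]big_mkcond big_seq [leRHS]big_seq.
apply: ler_sum => p ps; have [p0 _] := (sK n).1 _ ps.
case: ifP => h; first by rewrite (leq_trans h ij).
by case: ifP.
Qed.

Lemma cmass0 n k : cmass n k 0%N = 0.
Proof. by rewrite /cmass big_pred0. Qed.

Lemma cmassT n k : cmass n k (4 ^ k) = 1.
Proof.
rewrite -[RHS](sK n).2 /cmass big_mkcond big_seq [RHS]big_seq.
apply: eq_bigr => p ps; rewrite ifT//.
by have [+ _ _] := idxP k; apply; have [_] := (sK n).1 _ ps.
Qed.

Lemma cmassS n k j : cmass n k j = cmass n k.+1 (j * 4).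
Proof.
rewrite /cmass big_mkcond [RHS]big_mkcond big_seq [RHS]big_seq.
apply: eq_bigr => p ps; have [_ Kp] := (sK n).1 _ ps.
by have [_ /(_ _ Kp) -> _] := idxP k; rewrite ltn_divLR.
Qed.

Lemma lim_mass_mono k i j : (i <= j)%N -> G k i <= G k j.
Proof.
move=> ij; apply: (ler_cvg_to (Gcvg k i) (Gcvg k j)).
by apply: nearW => n; exact: cmass_mono.
Qed.

Lemma lim_mass0 k : G k 0%N = 0.
Proof.
have H := Gcvg k 0%N.
rewrite (_ : (fun n => cmass n k 0%N) = cst 0) in H; last by apply/funext => n; rewrite cmass0.
exact: (cvg_unique _ H (cvg_cst _)).
Qed.

Lemma lim_massT k : G k (4 ^ k)%N = 1.
Proof.
have H := Gcvg k (4 ^ k)%N.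
rewrite (_ : (fun n => cmass n k (4 ^ k)%N) = cst 1) in H; last by apply/funext => n; rewrite cmassT.
exact: (cvg_unique _ H (cvg_cst _)).
Qed.

Lemma lim_massS k j : G k j = G k.+1 (j * 4)%N.
Proof.
have H := Gcvg k j.
rewrite (_ : (fun n => cmass n k j) = (fun n => cmass n k.+1 (j * 4)%N)) in H; last first.
  by apply/funext => n; rewrite cmassS.
exact: (cvg_unique _ H (Gcvg _ _)).
Qed.

(* Quantile transform along the nested dyadic cells: [cell k j] is an interval
   whose length is the limiting mass of the [j]-th dyadic cell of level [k], and
   [cellno k t] is the index of the interval containing [t].  Sending [t] to the
   point where the corresponding dyadic cells shrink transports Lebesgue measure
   on [0, 1[ to the weak limit. *)
Definition cellno k (t : R) : nat := \max_(j < (4 ^ k).+1 | G k j <= t) j.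

(** A Galois connection between [cellno k] and the limiting distribution function, from its
    monotonicity and its value 0 at 0. *)
Lemma cellno_le k (t : R) j : 0 <= t -> (j <= 4 ^ k)%N ->
  (j <= cellno k t)%N = (G k j <= t).
Proof.
move=> t0 jk; apply/idP/idP; last first.
  move=> h; have jk' : (j < (4 ^ k).+1)%N by [].
  exact: (@leq_bigmax_cond _ (fun i : 'I_(4 ^ k).+1 => (G k i <= t)%R)
    (fun i => i : nat) (Ordinal jk') h).
have : (0 < #|[pred i : 'I_(4 ^ k).+1 | (G k i <= t)%R]|)%N.
  by apply/card_gt0P; exists ord0; rewrite inE /= lim_mass0.
move=> /(@eq_bigmax_cond _ _ (fun i : 'I_(4 ^ k).+1 => i : nat)) [i ih E] h.
have E' : cellno k t = i by exact: E.
rewrite E' in h.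
by apply: le_trans (lim_mass_mono k _ _ h) _; rewrite inE in ih.
Qed.

Lemma cellno_lt k (t : R) : 0 <= t < 1 -> (cellno k t < 4 ^ k)%N.
Proof.
by move=> /andP[t0 t1]; rewrite ltnNge cellno_le// lim_massT -ltNge.
Qed.

Lemma cellnoS k (t : R) : 0 <= t < 1 -> cellno k t = (cellno k.+1 t %/ 4)%N.
Proof.
move=> t01; have /andP[t0 t1] := t01; apply/eqP; rewrite eqn_leq; apply/andP; split.
  have h : (cellno k t <= 4 ^ k)%N by rewrite ltnW// cellno_lt.
  rewrite leq_divRL// cellno_le//; last by rewrite expnSr leq_mul2r.
  by rewrite -lim_massS -cellno_le.
have h : (cellno k.+1 t %/ 4 <= 4 ^ k)%N.
  rewrite -[X in (_ <= X)%N](@mulnK _ 4)// leq_div2r// -expnSr ltnW//.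
  exact: cellno_lt.
rewrite cellno_le// lim_massS -cellno_le//; last by rewrite expnSr leq_mul2r.
exact: leq_trunc_div.
Qed.

(** The default [x0] belongs to K, so representatives of empty cells still lie in K. *)
Definition rep k (j : nat) : Pl := xget x0 [set x | K x /\ idx k x = j].

Lemma repK k j : K (rep k j).
Proof. by rewrite /rep; case: xgetP => [x -> []|]. Qed.

Lemma idx_rep k j x : K x -> idx k x = j -> idx k (rep k j) = j.
Proof.
move=> Kx E; have [] := @xgetPex _ x0 [set x | K x /\ idx k x = j] => //.
by exists x.
Qed.

(** A cell that misses K has no mass for any n, so its limiting interval is empty and cannot contain
    t. Hence the default value of [rep] never occurs here. *)
Lemma idx_rep_cellno k (t : R) : 0 <= t < 1 -> idx k (rep k (cellno k t)) = cellno k t.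
Proof.
move=> t01; have /andP[t0 t1] := t01.
have [[x [Kx E]]|H] := pselect (exists x, K x /\ idx k x = cellno k t).
  exact: idx_rep Kx E.
have jk := cellno_lt k t t01.
have h1 : G k (cellno k t) <= t by rewrite -cellno_le// ltnW.
have h2 : t < G k (cellno k t).+1 by rewrite ltNge -cellno_le// ltnn.
suff E : G k (cellno k t) = G k (cellno k t).+1 by move: h2; rewrite -E ltNge h1.
have C := Gcvg k (cellno k t).
rewrite (_ : (fun n => cmass n k (cellno k t)) = (fun n => cmass n k (cellno k t).+1)) in C.
  exact: (cvg_unique _ C (Gcvg _ _)).
apply/funext => n; rewrite /cmass big_mkcond [RHS]big_mkcond big_seq [RHS]big_seq.
apply: eq_bigr => p ps; have [_ Kp] := (sK n).1 _ ps.
rewrite [in RHS]ltnS [in RHS]leq_eqVlt; case: eqP => //= E.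
by exfalso; apply: H; exists p.2.
Qed.

Definition cell k j : set RM := `[G k j, G k j.+1[%classic.

Definition step (c : nat -> R) k (t : RM) : RM := \sum_(j < 4 ^ k) c j * \1_(cell k j) t.

Lemma measurable_cell k j : measurable (cell k j).
Proof. exact: measurable_itv. Qed.

Lemma measurable_step c k : measurable_fun setT (step c k).
Proof.
apply: measurable_sum => j; apply: measurable_funM; first exact: measurable_cst.
by apply: measurable_indic; exact: measurable_cell.
Qed.

Lemma in_cell k j (t : R) : 0 <= t < 1 -> (j < 4 ^ k)%N ->
  (t \in cell k j) = (j == cellno k t).
Proof.
move=> /andP[t0 t1] jk.
have -> : (t \in cell k j) = (G k j <= t < G k j.+1).
  by apply/idP/idP; rewrite inE /cell /= in_itv.
by rewrite -(cellno_le k t j t0 (ltnW jk)) ltNge -(cellno_le k t j.+1 t0 jk) -leqNgt -eqn_leq.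
Qed.

Lemma stepE c k (t : R) : 0 <= t < 1 -> step c k t = c (cellno k t).
Proof.
move=> t01; have jk := cellno_lt k t t01.
rewrite /step (bigD1 (Ordinal jk))//= big1 ?addr0.
  by rewrite indicE in_cell// eqxx mulr1.
by move=> i; rewrite -val_eqE /= => /negbTE ni; rewrite indicE in_cell// ni mulr0.
Qed.

Lemma step_out c k (t : R) : ~~ (0 <= t < 1) -> step c k t = 0.
Proof.
move=> t01; rewrite /step big1// => j _; rewrite indicE.
case: (boolP (_ \in _)) => [|_]; last by rewrite mulr0.
rewrite inE /cell /= in_itv/= => /andP[h1 h2].
exfalso; move/negP : t01; apply; apply/andP; split.
  by apply: le_trans h1; rewrite -(lim_mass0 k) lim_mass_mono.
by apply: lt_le_trans h2 _; rewrite -(lim_massT k) lim_mass_mono.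
Qed.

Lemma integral_step (c : nat -> R) k : (forall j, 0 <= c j) ->
  (\int[mu]_(t in `[0%R, 1%R[) (step c k t)%:E =
   (\sum_(j < 4 ^ k) c j * (G k j.+1 - G k j))%R%:E)%E.
Proof.
move=> c0; rewrite -sumEFin.
under eq_integral do rewrite /step -sumEFin.
rewrite ge0_integral_sum//=.
- apply: eq_bigr => j _.
  under eq_integral do rewrite EFinM.
  rewrite ge0_integralZl_EFin; [|by []|by move=> t _; rewrite lee_fin|
    by apply/measurable_EFinP; apply: measurable_indic; exact: measurable_cell|exact: c0].
  rewrite integral_indic//; last exact: measurable_cell.
  rewrite setIidl; last first.
    move=> t; rewrite /cell /= !in_itv/= => /andP[h1 h2]; apply/andP; split.
      by apply: le_trans h1; rewrite -(lim_mass0 k) lim_mass_mono.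
    by apply: lt_le_trans h2 _; rewrite -(lim_massT k) lim_mass_mono.
  have E : (mu `[G k j, G k j.+1[ = (G k j.+1 - G k j)%:E)%E.
    rewrite lebesgue_measure_itv/= lte_fin; case: ltP => [_|h]; first by rewrite -EFinD.
    by rewrite (_ : G k j.+1 = G k j) ?subrr//; apply/eqP; rewrite eq_le h lim_mass_mono.
  by transitivity ((c j)%:E * mu `[G k j, G k j.+1[%classic)%E; rewrite // E -EFinM.
- move=> j; apply/measurable_EFinP; apply: measurable_funM; first exact: measurable_cst.
  by apply: measurable_indic; exact: measurable_cell.
- by move=> j t _; rewrite lee_fin mulr_ge0.
Qed.

Definition Yk k (t : RM) : RM * RM :=
  (step (fun j => (rep k j).1) k t, step (fun j => (rep k j).2) k t).

Lemma YkE k (t : R) : 0 <= t < 1 -> Yk k t = rep k (cellno k t).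
Proof. by move=> t01; rewrite /Yk !stepE// -surjective_pairing. Qed.

(** The cells selected by one t are nested, because [idx] and [cellno] both pass to the coarser
    level by division by 4. This makes the points [Yk k t] a Cauchy sequence. *)
Lemma idx_Yk k l (t : R) : 0 <= t < 1 -> (k <= l)%N -> idx k (Yk l t) = cellno k t.
Proof.
move=> t01 kl; rewrite -(subnK kl); move: (l - k)%N => m {kl}.
elim: m k => [|m IH] k.
  by rewrite add0n YkE// idx_rep_cellno.
have KY : K (Yk (m.+1 + k) t) by rewrite YkE//; exact: repK.
have [_ /(_ _ KY) -> _] := idxP k.
by rewrite addSnnS IH -cellnoS.
Qed.

Lemma Yk_close k l (t : R) : 0 <= t < 1 -> (k <= l)%N ->
  `|(Yk k t).1 - (Yk l t).1| <= 4 * M / 2 ^+ k /\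
  `|(Yk k t).2 - (Yk l t).2| <= 4 * M / 2 ^+ k.
Proof.
move=> t01 kl; have [_ _] := idxP k; apply; rewrite ?idx_Yk//;
  rewrite YkE//; exact: repK.
Qed.

Lemma cvg_pow2 : (4 * M / 2 ^+ k) @[k --> \oo] --> (0 : R).
Proof.
rewrite -[X in _ --> X](mulr0 (4 * M)); apply: cvgM; first exact: cvg_cst.
have := @cvg_geometric R 1 (2^-1).
rewrite gtr0_norm ?invr_gt0// invf_lt1// => /(_ (ltr1n R 2)).
by apply: cvg_trans; apply: near_eq_cvg; apply: nearW => k; rewrite /= mul1r exprVn.
Qed.

Lemma cvg_step_rep (f : Pl -> R) : (forall k l (t : R), 0 <= t < 1 -> (k <= l)%N ->
    `|f (rep k (cellno k t)) - f (rep l (cellno l t))| <= 4 * M / 2 ^+ k) ->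
  forall t, cvg ((step (fun j => f (rep k j)) k t) @[k --> \oo]).
Proof.
move=> H t; have [t01|t01] := boolP (0 <= t < 1); last first.
  under eq_fun do rewrite step_out//; exact: is_cvg_cst.
under eq_fun do rewrite stepE//.
apply/cauchy_cvgP; apply: cauchy_exP => e e0.
have /cvgr0Pnorm_lt/(_ _ e0) [N _ HN] := cvg_pow2.
exists (f (rep N (cellno N t))); exists N => // n /= Nn.
rewrite /ball/=; apply: le_lt_trans (H _ _ _ t01 Nn) _.
by apply: le_lt_trans (ler_norm _) _; apply: HN => /=.
Qed.

Lemma cvg_Yk1 t : cvg ((Yk k t).1 @[k --> \oo]).
Proof.
apply: (@cvg_step_rep fst) => k l u u01 kl.
by have [+ _] := Yk_close k l u u01 kl; rewrite !YkE.
Qed.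

Lemma cvg_Yk2 t : cvg ((Yk k t).2 @[k --> \oo]).
Proof.
apply: (@cvg_step_rep snd) => k l u u01 kl.
by have [_] := Yk_close k l u u01 kl; rewrite !YkE.
Qed.

Definition Xlim (t : RM) : RM * RM :=
  (limn (fun k => (Yk k t).1), limn (fun k => (Yk k t).2)).

Lemma Xlim_close k (t : R) : 0 <= t < 1 ->
  `|(Xlim t).1 - (Yk k t).1| <= 4 * M / 2 ^+ k /\
  `|(Xlim t).2 - (Yk k t).2| <= 4 * M / 2 ^+ k.
Proof.
move=> t01; split.
- have C : `|(Yk l t).1 - (Yk k t).1| @[l --> \oo] --> `|(Xlim t).1 - (Yk k t).1|.
    by apply: cvg_norm; apply: cvgB; [exact: cvg_Yk1|exact: cvg_cst].
  apply: (cvgr_to_le C); exists k => // l /= kl.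
  by rewrite distrC; have [] := Yk_close k l t t01 kl.
- have C : `|(Yk l t).2 - (Yk k t).2| @[l --> \oo] --> `|(Xlim t).2 - (Yk k t).2|.
    by apply: cvg_norm; apply: cvgB; [exact: cvg_Yk2|exact: cvg_cst].
  apply: (cvgr_to_le C); exists k => // l /= kl.
  by rewrite distrC; have [] := Yk_close k l t t01 kl.
Qed.

Lemma XlimK (t : R) : 0 <= t < 1 -> K (Xlim t).
Proof.
move=> t01; have C : Yk k t @[k --> \oo] --> (Xlim t : Pl).
  by apply: (@cvg_pair _ _ _ _ (nbhs (Xlim t).1) (nbhs (Xlim t).2)
    _ _ _ (fun k => (Yk k t).1) (fun k => (Yk k t).2)); [exact: cvg_Yk1|exact: cvg_Yk2].
apply: (closed_cvg K clK _ _ C).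
by apply: nearW => k; rewrite YkE//; exact: repK.
Qed.

Lemma measurable_Xlim : measurable_fun setT Xlim.
Proof.
apply: measurable_fun_pair.
- apply: (@measurable_fun_cvg _ _ _ _ (fun k t => (Yk k t).1)).
    by move=> k; exact: measurable_step.
  by move=> t _; exact: cvg_Yk1.
- apply: (@measurable_fun_cvg _ _ _ _ (fun k t => (Yk k t).2)).
    by move=> k; exact: measurable_step.
  by move=> t _; exact: cvg_Yk2.
Qed.

(** Increments of the distribution function are cell masses, so the left side integrates a function
    constant on cells. *)
Lemma sum_cells n k (c : nat -> R) :
  \sum_(j < 4 ^ k) c j * (cmass n k j.+1 - cmass n k j) =
  \sum_(p <- s n) p.1 * c (idx k p.2).
Proof.
have E j : cmass n k j.+1 - cmass n k j =
    \sum_(p <- s n) (if idx k p.2 == j then p.1 else 0).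
  rewrite /cmass [X in X - _]big_mkcond [X in _ - X]big_mkcond -sumrB.
  apply: eq_bigr => p _; rewrite ltnS leq_eqVlt.
  by case: eqP => [->|_] /=; rewrite ?ltnn ?subr0//; case: ifP; rewrite subrr.
under eq_bigr do rewrite E mulr_sumr.
rewrite exchange_big /= big_seq [RHS]big_seq; apply: eq_bigr => p ps.
have [_ Kp] := (sK n).1 _ ps; have [/(_ _ Kp) h _ _] := idxP k.
rewrite (bigD1 (Ordinal h))//= eqxx big1 ?addr0; first by rewrite mulrC.
by move=> i; rewrite -val_eqE /= eq_sym => /negbTE ->; rewrite mulr0.
Qed.

Lemma cvg_rsum (I : Type) (r : seq I) (f : I -> nat -> R) (l : I -> R) :
  (forall i, f i n @[n --> U] --> l i) ->
  (\sum_(i <- r) f i n) @[n --> U] --> \sum_(i <- r) l i.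
Proof.
move=> H; elim: r => [|i r IH].
  rewrite (_ : (fun n => _) = cst 0); last by apply/funext => n; rewrite big_nil.
  by rewrite big_nil; exact: cvg_cst.
rewrite (_ : (fun n => _) = (fun n => f i n + \sum_(j <- r) f j n)); last first.
  by apply/funext => n; rewrite big_cons.
by rewrite big_cons; exact: cvgD.
Qed.

(** At a fixed level k the discretised energy is a finite polynomial in the cumulative masses, so it
    passes to the limit along U. The error comes from moving each atom to the representative of its
    cell, by at most 4M / 2^k in each coordinate. *)
Lemma limit_energy (e : R) (V : R) k : 0 < e ->
  (\forall n \near U, aen e (s n) <= V) ->
  \sum_(i < 4 ^ k) (\sum_(j < 4 ^ k) kap e (rep k i) (rep k j) *
     (G k j.+1 - G k j)) * (G k i.+1 - G k i) <=
  V + 8 * M * (4 * M / 2 ^+ k) / e ^+ 2.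
Proof.
move=> e0 HV.
have C : (\sum_(i < 4 ^ k) (\sum_(j < 4 ^ k) kap e (rep k i) (rep k j) *
     (cmass n k j.+1 - cmass n k j)) * (cmass n k i.+1 - cmass n k i)) @[n --> U] -->
   \sum_(i < 4 ^ k) (\sum_(j < 4 ^ k) kap e (rep k i) (rep k j) *
     (G k j.+1 - G k j)) * (G k i.+1 - G k i).
  apply: cvg_rsum => i; apply: cvgM; last by apply: cvgB; exact: Gcvg.
  apply: cvg_rsum => j; apply: cvgM; first exact: cvg_cst.
  by apply: cvgB; exact: Gcvg.
apply: (cvgr_to_le C); apply: filterS HV => n HV.
have h0 : 0 <= 4 * M / 2 ^+ k by rewrite divr_ge0 ?exprn_ge0// mulr_ge0// ltW.
rewrite (sum_cells n k (fun i => \sum_(j < 4 ^ k) kap e (rep k i) (rep k j) *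
     (cmass n k j.+1 - cmass n k j))).
under eq_bigr => p _ do rewrite (sum_cells n k (fun j => kap e (rep k (idx k p.2)) (rep k j))).
set w := 8 * M * _ / _.
apply: (@le_trans _ _ (\sum_(p <- s n) \sum_(q <- s n) (p.1 * q.1 * kap e p.2 q.2 + p.1 * q.1 * w))).
  rewrite big_seq [leRHS]big_seq; apply: ler_sum => p ps.
  rewrite mulr_sumr big_seq [leRHS]big_seq; apply: ler_sum => q qs.
  have [p0 Kp] := (sK n).1 _ ps; have [q0 Kq] := (sK n).1 _ qs.
  rewrite mulrA -mulrDr ler_wpM2l ?mulr_ge0//.
  have [_ _ cl] := idxP k.
  have [a1 a2] := cl _ _ (repK k (idx k p.2)) Kp (idx_rep k _ _ Kp erefl).
  have [b1 b2] := cl _ _ (repK k (idx k q.2)) Kq (idx_rep k _ _ Kq erefl).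
  have [r1 r2] := KM _ (repK k (idx k p.2)); have [r3 r4] := KM _ (repK k (idx k q.2)).
  have [p1 p2] := KM _ Kp; have [q1 q2] := KM _ Kq.
  exact: kap_modulus.
under eq_bigr do rewrite big_split /=.
rewrite big_split /= lerD//.
under eq_bigr => p _ do rewrite -mulr_suml -mulr_sumr (sK n).2 mulr1.
by rewrite -mulr_suml (sK n).2 mul1r.
Qed.

Local Notation unif := (uniform_prob (@ltr01 R)).

(** Everything outside [0, 1[ is sent to 0, so that [Xlaw] takes values in K at every real number,
    including the endpoint 1 of the uniform law. *)
Definition clamp (t : RM) : RM := t * \1_(`[0, 1[%classic : set RM) t.

Lemma clampE (t : R) : 0 <= t < 1 -> clamp t = t.
Proof. by move=> t01; rewrite /clamp indicE mem_set ?mulr1//= in_itv. Qed.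

Lemma clamp01 (t : R) : 0 <= clamp t < 1.
Proof.
rewrite /clamp indicE; case: (boolP (_ \in _)).
  by rewrite inE /= in_itv/= mulr1.
by move=> _; rewrite mulr0 lexx ltr01.
Qed.

Lemma measurable_clamp : measurable_fun setT clamp.
Proof.
apply: measurable_funM; first exact: measurable_id.
by apply: measurable_indic; exact: measurable_itv.
Qed.

Lemma integral_step_unif (c : nat -> R) k : (forall j, 0 <= c j) ->
  (\int[unif]_t (step c k (clamp t))%:E =
   (\sum_(j < 4 ^ k) c j * (G k j.+1 - G k j))%R%:E)%E.
Proof.
move=> c0.
have m : measurable_fun setT (fun t => step c k (clamp t)).
  by apply: (measurableT_comp (measurable_step c k)); exact: measurable_clamp.
rewrite integral_uniform.
- rewrite subr0 invr1 mul1e -integral_step// -integral_itv_bndo_bndc.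
    apply: eq_integral => t; rewrite inE /= in_itv/= => t01.
    by rewrite clampE.
  by apply: measurable_funTS; apply/measurable_EFinP.
- exact/measurable_EFinP.
- by move=> t; rewrite lee_fin stepE ?clamp01.
Qed.

Definition Xlaw (t : RM) : RM * RM := Xlim (clamp t).

Lemma measurable_Xlaw : measurable_fun setT Xlaw.
Proof. by apply: (measurableT_comp measurable_Xlim); exact: measurable_clamp. Qed.

Lemma XlawK t : K (Xlaw t).
Proof. by apply: XlimK; exact: clamp01. Qed.

Lemma sum_lim_mass k : \sum_(j < 4 ^ k) (G k j.+1 - G k j) = 1.
Proof.
transitivity (\sum_(0 <= j < 4 ^ k) (G k j.+1 - G k j)); first by rewrite big_mkord.
by rewrite telescope_sumr// lim_massT lim_mass0 subr0.
Qed.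

Lemma measurable_kap_comp (e : R) d (T : measurableType d) (f g : T -> RM * RM) :
  measurable_fun setT f -> measurable_fun setT g ->
  measurable_fun setT (fun t => kap e (f t) (g t)).
Proof.
move=> /measurable_fun_pairP[f1 f2] /measurable_fun_pairP[g1 g2].
rewrite /kap /sqd; apply: measurable_funM; last exact: measurable_cst.
apply: measurableT_comp => //; apply: measurableT_comp; first exact: measurable_ln.
apply: measurable_funD; last exact: measurable_cst.
by apply: measurable_funD; apply: measurable_funX; apply: measurable_funB.
Qed.

Lemma Xlaw_energy (e V B : R) : 0 < e ->
  (\forall n \near U, aen e (s n) <= V) ->
  (forall x y, K x -> K y -> 0 <= kap e x y + B) ->
  (\int[unif]_u \int[unif]_t (kap e (Xlaw u) (Xlaw t) + B)%:E <= (V + B)%:E)%E.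
Proof.
move=> e0 HV kB.
pose w k := 8 * M * (4 * M / 2 ^+ k) / e ^+ 2.
have w0 k : 0 <= w k.
  by rewrite /w divr_ge0 ?exprn_ge0 ?(ltW e0)// !mulr_ge0// ?invr_ge0 ?exprn_ge0// ltW.
(* One [w k] for moving the limit points to representatives, one from [limit_energy]; both vanish as
   k grows. *)
suff H k : (\int[unif]_u \int[unif]_t (kap e (Xlaw u) (Xlaw t) + B)%:E <= (V + B + 2 * w k)%:E)%E.
  have C : (V + B + 2 * w k)%:E @[k --> \oo] --> (V + B)%:E.
    apply: cvg_EFin; first exact: nearW.
    rewrite -[X in _ --> X]addr0; apply: cvgD; first exact: cvg_cst.
    rewrite -[X in _ --> X](mulr0 2); apply: cvgM; first exact: cvg_cst.
    rewrite -[X in _ --> X](mul0r (e ^+ 2)^-1); apply: cvgM; last exact: cvg_cst.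
    rewrite -[X in _ --> X](mulr0 (8 * M)); apply: cvgM; first exact: cvg_cst.
    exact: cvg_pow2.
  have := cvg_lim (@ereal_hausdorff R) C => <-.
  by apply: lime_ge; [exact: (cvgP _ C)|apply: nearW].
have mod (u t : RM) : kap e (Xlaw u) (Xlaw t) + B <=
    kap e (rep k (cellno k (clamp u))) (rep k (cellno k (clamp t))) + B + w k.
  have [a1 a2] := Xlim_close k _ (clamp01 u); have [b1 b2] := Xlim_close k _ (clamp01 t).
  have [x1 x2] := KM _ (XlawK u); have [y1 y2] := KM _ (XlawK t).
  have [r1 r2] := KM _ (repK k (cellno k (clamp u))).
  have [r3 r4] := KM _ (repK k (cellno k (clamp t))).
  rewrite !YkE ?clamp01// in a1 a2 b1 b2.
  rewrite addrAC lerD2r; apply: kap_modulus => //.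
  by rewrite divr_ge0 ?exprn_ge0// mulr_ge0// ltW.
have mX := measurable_Xlaw.
have m2 u : measurable_fun setT (fun t => (kap e (Xlaw u) (Xlaw t) + B)%:E).
  apply/measurable_EFinP; apply: measurable_funD; last exact: measurable_cst.
  by apply: measurable_kap_comp => //; exact: measurable_cst.
pose c i := fun j => kap e (rep k i) (rep k j) + B + w k.
have c0 i j : 0 <= c i j by rewrite /c addr_ge0// kB//; exact: repK.
pose C i : R := \sum_(j < 4 ^ k) c i j * (G k j.+1 - G k j).
have C0 i : 0 <= C i by apply: sumr_ge0 => j _; rewrite mulr_ge0// subr_ge0 lim_mass_mono.
have inner u : (\int[unif]_t (kap e (Xlaw u) (Xlaw t) + B)%:E <= (step C k (clamp u))%:E)%E.
  rewrite stepE ?clamp01// /C -integral_step_unif//.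
  apply: ge0_le_integral => //.
  - by move=> t _; rewrite lee_fin kB//; exact: XlawK.
  - apply/measurable_EFinP; apply: (measurableT_comp (measurable_step _ k)).
    exact: measurable_clamp.
  - by move=> t _; rewrite lee_fin stepE ?clamp01.
apply: (@le_trans _ _ (\int[unif]_u (step C k (clamp u))%:E)%E).
  apply: ge0_le_integral => //.
  - by move=> u _; apply: integral_ge0 => t _; rewrite lee_fin kB//; exact: XlawK.
  - apply: (@measurable_fun_fubini_tonelli_F _ _ _ _ _ unif
      (fun p : RM * RM => (kap e (Xlaw p.1) (Xlaw p.2) + B)%:E)).
      apply/measurable_EFinP; apply: measurable_funD; last exact: measurable_cst.
      by apply: measurable_kap_comp; apply: (measurableT_comp mX);
        [exact: measurable_fst|exact: measurable_snd].
    by move=> p; rewrite lee_fin kB//; exact: XlawK.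
  - apply/measurable_EFinP; apply: (measurableT_comp (measurable_step _ k)).
    exact: measurable_clamp.
rewrite integral_step_unif// lee_fin /C /c.
have := limit_energy e V k e0 HV; rewrite -/(w k).
set S := (X in X <= _) => HS.
have -> : \sum_(i < 4 ^ k) (\sum_(j < 4 ^ k) (kap e (rep k i) (rep k j) + B + w k) *
    (G k j.+1 - G k j)) * (G k i.+1 - G k i) = S + (B + w k); last by lra.
transitivity (\sum_(i < 4 ^ k) ((\sum_(j < 4 ^ k) kap e (rep k i) (rep k j) *
    (G k j.+1 - G k j)) * (G k i.+1 - G k i) + (B + w k) * (G k i.+1 - G k i))).
  apply: eq_bigr => i _; rewrite -mulrDl; congr (_ * _).
  under eq_bigr do rewrite -addrA mulrDl.
  by rewrite big_split /= -mulr_sumr sum_lim_mass mulr1.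
by rewrite big_split /= -mulr_sumr sum_lim_mass mulr1.
Qed.

End WeakLimit.

(** * Logarithmic energy of a law by monotone convergence *)

Section EnergyOfLaw.
Context {R : realType}.
Local Notation Pl := (R * R)%type.

Lemma measurable_kap2 (e : R) :
  measurable_fun setT (fun p : Pl * Pl => kap e p.1 p.2).
Proof.
rewrite /kap /sqd; apply: measurable_funM; last exact: measurable_cst.
apply: measurableT_comp => //; apply: measurableT_comp; first exact: measurable_ln.
apply: measurable_funD; last exact: measurable_cst.
apply: measurable_funD; apply: measurable_funX; apply: measurable_funB.
- by apply: (measurableT_comp measurable_fst); exact: measurable_fst.
- by apply: (measurableT_comp measurable_fst); exact: measurable_snd.
- by apply: (measurableT_comp measurable_snd); exact: measurable_fst.
- by apply: (measurableT_comp measurable_snd); exact: measurable_snd.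
Qed.

Lemma energy_of_law d (T : measurableType d) (P : probability T R)
    (X : {mfun T >-> Pl}) (K : set Pl) (B V : R) (e : nat -> R) :
  measurable (~` K) -> (forall t, K (X t)) ->
  (forall n, 0 < e n) -> (forall n m, (n <= m)%N -> e m <= e n) ->
  e n @[n --> \oo] --> (0 : R) ->
  (forall n x y, K x -> K y -> 0 <= kap (e n) x y + B) ->
  (forall n, (\int[P]_u \int[P]_t (kap (e n) (X u) (X t) + B)%:E <= (V + B)%:E)%E) ->
  (log_energy (distribution P X) <= V%:E)%E.
Proof.
move=> mK XK e0 enon ecvg kB HE.
pose nu : probability Pl R := distribution P X.
rewrite -/nu.
(* On K x K, which carries the product measure, the maximum changes nothing; elsewhere it gives the
   sign required by Tonelli and by monotone convergence. *)
pose f n (p : Pl * Pl) : \bar R := (Num.max (kap (e n) p.1 p.2 + B) 0)%:E.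
pose F (p : Pl * Pl) : \bar R := limn (f ^~ p).
have f0 n p : (0 <= f n p)%E by rewrite lee_fin le_max lexx orbT.
have mf n : measurable_fun setT (f n).
  apply/measurable_EFinP; apply: measurable_maxr; last exact: measurable_cst.
  by apply: measurable_funD; [exact: measurable_kap2|exact: measurable_cst].
have ndf p : {homo f ^~ p : n m / (n <= m)%N >-> (n <= m)%E}.
  move=> n m nm; rewrite lee_fin ge_max !le_max lexx orbT andbT lerD2r.
  by rewrite kap_mono ?enon.
have cf p : f n p @[n --> \oo] --> F p by exact: ereal_nondecreasing_is_cvgn.
have F0 p : (0 <= F p)%E.
  by apply: lime_ge; [exact: ereal_nondecreasing_is_cvgn|exact: nearW].
have mF : measurable_fun setT F by apply: (emeasurable_fun_cvg f).
have FK z w : K z -> K w -> F (z, w) = (log_kernel z w + B%:E)%E.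
  move=> Kz Kw; apply: (cvg_lim (@ereal_hausdorff R)).
  have -> : f ^~ (z, w) = (fun n => (kap (e n) z w)%:E + B%:E)%E.
    by apply/funext => n; rewrite /f /= max_l ?kB.
  apply: cvgeD; [exact: fin_num_adde_defl| |exact: cvg_cst].
  exact: cvg_kap_log_kernel.
have If n : (\int[nu \x nu]_p f n p <= (V + B)%:E)%E.
  rewrite fubini_tonelli1//.
  rewrite ge0_integral_distribution//; last 2 first.
  - exact: measurable_fun_fubini_tonelli_F.
  - by move=> z; apply: integral_ge0 => w _.
  apply: le_trans (HE n); rewrite le_eqVlt; apply/orP; left; apply/eqP.
  apply: eq_integral => u _; rewrite /= /fubini_F ge0_integral_distribution//.
  - by apply: eq_integral => t _; rewrite /f /= max_l// kB.
  - exact: measurable_fun_pair2.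
have IF : (\int[nu \x nu]_p F p <= (V + B)%:E)%E.
  rewrite monotone_convergence//.
  apply: lime_le; last exact: nearW.
  apply: ereal_nondecreasing_is_cvgn => n m nm; apply: ge0_le_integral => //.
  by move=> p _; exact: ndf.
pose Fz (z : Pl) : \bar R := (\int[nu]_w F (z, w))%E.
have mFz : measurable_fun setT Fz by exact: measurable_fun_fubini_tonelli_F.
have Fz0 z : (0 <= Fz z)%E by apply: integral_ge0 => w _.
have IFz : (\int[nu]_z Fz z <= (V + B)%:E)%E.
  by move: IF; rewrite fubini_tonelli1.
have iFz : nu.-integrable setT Fz.
  apply/integrableP; split => //.
  under eq_integral do rewrite gee0_abs//.
  by apply: le_lt_trans IFz _; rewrite ltry.
have nuK : nu (~` K) = 0%E.
  rewrite /nu /= /distribution /pushforward (_ : _ @^-1` _ = set0) ?measure0//.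
  by apply/seteqP; split => // t /=; apply; exact: XK.
have mk : measurable_fun setT (fun p : Pl * Pl => log_kernel p.1 p.2).
  apply: (emeasurable_fun_cvg (fun n (p : Pl * Pl) => (kap (e n) p.1 p.2)%:E)).
    by move=> n; apply/measurable_EFinP; exact: measurable_kap2.
  by move=> p _; exact: cvg_kap_log_kernel.
have mkz (z : Pl) : measurable_fun (setT : set Pl) (log_kernel z).
  pose g (p : Pl * Pl) : \bar R := log_kernel p.1 p.2.
  have H : measurable_fun (setT : set Pl) (fun w : Pl => g (z, w)).
    exact: measurable_fun_pair2.
  exact: H.
have iB : nu.-integrable setT (fun=> B%:E) by exact: finite_measure_integrable_cst.
have intB : (\int[nu]_w B%:E = B%:E)%E.
  by rewrite integral_cst//= probability_setT mule1.
have inner (z : Pl) : K z -> Fz z \is a fin_num ->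
    (\int[nu]_w log_kernel z w = Fz z - B%:E)%E.
  move=> Kz Fzf.
  have mFzw : measurable_fun setT (fun w : Pl => F (z, w)) by exact: measurable_fun_pair2.
  have iF : nu.-integrable setT (fun w : Pl => F (z, w)).
    apply/integrableP; split => //.
    under eq_integral do rewrite gee0_abs//.
    by rewrite ltey_eq Fzf.
  transitivity (\int[nu]_w (F (z, w) - B%:E))%E.
    apply: ae_eq_integral => //.
      by apply: emeasurable_funB => //; exact: measurable_cst.
    exists (~` K); split => // w /= H Kw; apply: H => _.
    by rewrite FK// addeK.
  by rewrite integralB// intB.
(* The kernel is signed, so Tonelli is applied to its positive and negative parts separately. *)
have mh : measurable_fun setT (fun z => \int[nu]_w log_kernel z w)%E.
  rewrite (_ : (fun z => _) = (fun z =>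
      \int[nu]_w (fun p : Pl * Pl => log_kernel p.1 p.2)^\+%E (z, w) -
      \int[nu]_w (fun p : Pl * Pl => log_kernel p.1 p.2)^\-%E (z, w))%E); last first.
    apply/funext => z; rewrite [LHS]integralE.
    by congr (_ - _)%E; apply: eq_integral => w _; rewrite ?funepos.unlock ?funeneg.unlock.
  apply: emeasurable_funB.
  - by apply: measurable_fun_fubini_tonelli_F => //; exact: measurable_funepos.
  - by apply: measurable_fun_fubini_tonelli_F => //; exact: measurable_funeneg.
(* B may be subtracted inside the inner integral wherever that integral is finite and z lies in K.
   The exceptional set is null because [Fz] is integrable. *)
have -> : log_energy nu = (\int[nu]_z (Fz z - B%:E))%E.
  rewrite /log_energy; apply: ae_eq_integral => //.
    by apply: emeasurable_funB => //; exact: measurable_cst.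
  have [N [mN N0 HN]] := integrable_ae measurableT iFz.
  exists (N `|` ~` K); split.
  - exact: measurableU.
  - by apply/null_set_setU => //.
  - move=> z /= H; apply: contrapT => /not_orP[nN /contrapT Kz]; apply: H => _.
    apply: inner => //; apply: contrapT => nf; apply: nN; apply: HN => /=.
    by move=> /(_ I).
rewrite integralB// intB leeBlDr//.
Qed.

End EnergyOfLaw.

(** * Energy and potential of finitely supported measures *)

Section Frostman.
Context {R : realType}.
Local Notation Pl := (R * R)%type.

Lemma aprob_nonempty (K : set Pl) s : aprob K s -> K !=set0.
Proof.
case: s => [|p s] [H E].
  by move: E; rewrite big_nil => /esym/eqP; rewrite oner_eq0.
by exists p.2; have [] := H p (mem_head _ _).
Qed.

Lemma weak_limit_energy (K : set Pl) (M V : R) (e : nat -> R) (s : nat -> seq (R * Pl)) :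
  0 < M -> (forall x, K x -> `|x.1| <= M /\ `|x.2| <= M) -> closed K ->
  (forall n, 0 < e n) -> (forall n m, (n <= m)%N -> e m <= e n) ->
  e n @[n --> \oo] --> (0 : R) ->
  (forall n, aprob K (s n)) -> (forall n, aen (e n) (s n) <= V) ->
  (robin K <= V%:E)%E.
Proof.
move=> M0 KM clK e0 enon ecvg sK HV.
have [x0 Kx0] := aprob_nonempty _ _ (sK 0%N).
have [idx idxP] := dyadic_index K M M0 KM.
have [U [UU FU]] := @ultraFilterLemma _ (\oo : set_system nat) _.
have PU : ProperFilter U by exact: ultra_proper.
have /choice[Gc HG] : forall kj : nat * nat, exists l : R,
    cmass s idx n kj.1 kj.2 @[n --> U] --> l.
  move=> [k j]; apply: ultra_limit01 => n /=; apply/andP; split.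
    rewrite /cmass big_seq_cond; apply: sumr_ge0 => p /andP[ps _].
    by have [] := (sK n).1 _ ps.
  rewrite -[leRHS](sK n).2 /cmass big_mkcond big_seq [leRHS]big_seq.
  apply: ler_sum => p ps; case: ifP => // _.
  by have [] := (sK n).1 _ ps.
pose G k j := Gc (k, j).
have Gcvg k j : cmass s idx n k j @[n --> U] --> G k j by exact: (HG (k, j)).
pose Z := @Xlaw R K idx G x0.
have mZ : measurable_fun setT Z by eapply measurable_Xlaw; eassumption.
have mZ' : measurable_fun (setT : set (measurableTypeR R)) (Z : measurableTypeR R -> Pl).
  exact: mZ.
pose X : {mfun measurableTypeR R >-> Pl} := HB.pack (Z : measurableTypeR R -> Pl)
  (isMeasurableFun.Build _ _ _ _ (Z : measurableTypeR R -> Pl) mZ').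
have ZK t : K (X t).
  by change (K (Z t)); eapply XlawK; eassumption.
(* On K the squared distance is at most 8 M^2 and e n <= e 0, so adding B makes every regularised
   kernel nonnegative. *)
pose B := ln (8 * M ^+ 2 + e 0%N ^+ 2) / 2.
have sqM x y : K x -> K y -> sqd x y <= 8 * M ^+ 2.
  move=> /KM[x1 x2] /KM[y1 y2]; have d (a b : R) : `|a| <= M -> `|b| <= M -> (a - b) ^+ 2 <= 4 * M ^+ 2.
    move=> ha hb; rewrite -real_normK ?num_real//.
    have -> : 4 * M ^+ 2 = (M + M) ^+ 2 by ring.
    rewrite ler_sqr ?nnegrE ?addr_ge0 ?(ltW M0)//.
    by apply: le_trans (ler_normB _ _) _; exact: lerD.
  by have := d _ _ x1 y1; have := d _ _ x2 y2; rewrite /sqd; lra.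
have kB n x y : K x -> K y -> 0 <= kap (e n) x y + B.
  move=> Kx Ky; rewrite -lerBlDr sub0r /B -mulNr; apply: kap_ge => //.
  by apply: lerD; [exact: sqM|rewrite ler_sqr ?nnegrE ?(ltW (e0 _))// enon].
have HE n : (\int[uniform_prob (@ltr01 R)]_u \int[uniform_prob (@ltr01 R)]_t
    (kap (e n) (X u) (X t) + B)%:E <= (V + B)%:E)%E.
  change (\int[uniform_prob (@ltr01 R)]_u \int[uniform_prob (@ltr01 R)]_t
    (kap (e n) (Z u) (Z t) + B)%:E <= (V + B)%:E)%E.
  eapply Xlaw_energy; try eassumption; [exact: e0| |exact: kB].
  (* The kernel stays at level n while the measure runs along m >= n; monotonicity in e bounds its
     level-n energy by its own level-m energy, hence by V. *)
  apply: FU; exists n => // m /= nm.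
  by apply: le_trans (HV m); apply: (aen_mono K _ _ _ (sK m)); rewrite ?enon.
apply: (@le_trans _ _ (log_energy (distribution (uniform_prob (@ltr01 R)) X))).
  apply: ereal_inf_lbound; exists (distribution (uniform_prob (@ltr01 R)) X) => //=.
  rewrite /distribution /pushforward (_ : _ @^-1` _ = set0) ?measure0//.
  by apply/seteqP; split => // t /=; apply; exact: ZK.
have mK : measurable (~` K) by apply: open_plane_measurable; exact: closed_openC.
eapply energy_of_law; eassumption.
Qed.

Lemma regularised_energy_bound (K : set Pl) (M V d s0 : R) :
  0 < M -> (forall x, K x -> `|x.1| <= M /\ `|x.2| <= M) -> closed K ->
  (V%:E <= robin K)%E -> 0 < d -> 0 < s0 ->
  exists e, [/\ 0 < e, e <= s0 & forall s, aprob K s -> V - d <= aen e s].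
Proof.
move=> M0 KM clK VK d0 s00; apply: contrapT => H.
pose e n : R := s0 / n.+1%:R.
have e0 n : 0 < e n by rewrite divr_gt0// ltr0n.
have enon n m : (n <= m)%N -> e m <= e n.
  by move=> nm; rewrite ler_pM2l// lef_pV2 ?posrE ?ltr0n// ler_nat.
have ecvg : e n @[n --> \oo] --> (0 : R).
  rewrite -[X in _ --> X](mulr0 s0); apply: cvgM; first exact: cvg_cst.
  exact: cvg_harmonic.
have /choice[s Hs] : forall n, exists s, aprob K s /\ aen (e n) s <= V - d.
  move=> n; apply: contrapT => Hn; apply: H; exists (e n); split => //.
    by rewrite ler_pdivrMr ?ltr0n// ler_peMr ?(ltW s00)// ler1n.
  move=> s sK; rewrite leNgt; apply/negP => h; apply: Hn; exists s; split => //.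
  exact: ltW.
have := @weak_limit_energy K M (V - d) e s M0 KM clK e0 enon ecvg
  (fun n => (Hs n).1) (fun n => (Hs n).2).
by move=> /(le_trans VK); rewrite lee_fin; lra.
Qed.

Definition apot (e : R) (s : seq (R * Pl)) (x : Pl) : R := \sum_(p <- s) p.1 * kap e p.2 x.

Lemma aen_apot e s : aen e s = \sum_(q <- s) q.1 * apot e s q.2.
Proof.
rewrite /aen exchange_big /=; apply: eq_bigr => q _.
by rewrite /apot mulr_sumr; apply: eq_bigr => p _; ring.
Qed.

Definition mix (t : R) (x : Pl) (s : seq (R * Pl)) : seq (R * Pl) :=
  (t, x) :: [seq ((1 - t) * p.1, p.2) | p <- s].

Lemma aprob_mix (K : set Pl) (t : R) x s : 0 <= t <= 1 -> K x -> aprob K s -> aprob K (mix t x s).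
Proof.
move=> /andP[t0 t1] Kx [sK s1]; split.
  move=> p; rewrite inE => /orP[/eqP -> //|/mapP[q /sK[q0 Kq] ->]] /=.
  by rewrite mulr_ge0// subr_ge0.
by rewrite big_cons big_map /= -mulr_sumr s1 mulr1 addrC subrK.
Qed.

Lemma apot_mix e t x s y : apot e (mix t x s) y = t * kap e x y + (1 - t) * apot e s y.
Proof.
rewrite /apot big_cons big_map /=; congr (_ + _).
by rewrite mulr_sumr; apply: eq_bigr => p _; rewrite -mulrA.
Qed.

Lemma aen_mix e t x s : aen e (mix t x s) =
  t ^+ 2 * kap e x x + 2 * t * (1 - t) * apot e s x + (1 - t) ^+ 2 * aen e s.
Proof.
rewrite aen_apot big_cons big_map /=.
under eq_bigr do rewrite apot_mix mulrDr.
rewrite big_split /= apot_mix.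
have -> : \sum_(p <- s) (1 - t) * p.1 * (t * kap e x p.2) = t * (1 - t) * apot e s x.
  by rewrite /apot mulr_sumr; apply: eq_bigr => p _; rewrite kapC; ring.
have -> : \sum_(p <- s) (1 - t) * p.1 * ((1 - t) * apot e s p.2) = (1 - t) ^+ 2 * aen e s.
  by rewrite aen_apot mulr_sumr; apply: eq_bigr => p _; ring.
by ring.
Qed.

(** The self-energy of a point mass is finite, so the quadratic term of the first variation in
    [potential_lower] is under control. *)
Lemma kap_diag (e : R) (x : Pl) : 0 < e -> kap e x x = - ln e.
Proof.
move=> e0; rewrite /kap /sqd !subrr expr0n /= addr0 add0r lnXn// mulr2n; lra.
Qed.

Lemma aen_le (K : set Pl) (e : R) s : 0 < e -> aprob K s -> aen e s <= - ln e.
Proof.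
move=> e0 [sK s1]; rewrite /aen.
apply: (@le_trans _ _ (\sum_(p <- s) \sum_(q <- s) p.1 * q.1 * - ln e)).
  rewrite big_seq [leRHS]big_seq; apply: ler_sum => p ps.
  rewrite big_seq [leRHS]big_seq; apply: ler_sum => q qs.
  by rewrite ler_wpM2l ?kap_le// mulr_ge0//; [have [] := sK _ ps|have [] := sK _ qs].
under eq_bigr do rewrite -mulr_suml -mulr_sumr s1 mulr1.
by rewrite -mulr_suml s1 mul1r.
Qed.

(* First variation: moving a little mass from an almost minimiser to any point
   of [K] cannot lower the energy much, so the potential is large on [K]. *)
Lemma potential_lower (K : set Pl) (e V d : R) : 0 < e -> 0 < d -> K !=set0 ->
  (forall s, aprob K s -> V <= aen e s) ->
  exists s, aprob K s /\ forall x, K x -> V - d <= apot e s x.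
Proof.
move=> e0 d0 [x0 Kx0] HV.
pose A := [set r | exists2 s, aprob K s & r = aen e s].
have s0K : aprob K [:: (1, x0)].
  by split; [move=> p; rewrite inE => /eqP -> /=|rewrite big_seq1].
have A0 : has_inf A.
  split; first by exists (aen e [:: (1, x0)]); exists [:: (1, x0)].
  by exists V => _ [s sK ->]; exact: HV.
pose C := - ln e - V.
have C0 : 0 <= C.
  by rewrite subr_ge0; apply: le_trans (HV _ s0K) _; exact: aen_le s0K.
(* With E the energy of the almost minimiser, comparison with the mixture gives 2t (1 - t) (p - E)
   >= - t d / 2 - t^2 (- ln e - E). Here - ln e - E <= C and t C <= d / 2, so the right side is at
   least - t d, and t <= 1/2 turns this into p - E >= - d. *)
pose t := Num.min (1 / 2) (d / (2 * (C + 1))).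
have C2 : 0 < 2 * (C + 1) by lra.
have t0 : 0 < t by rewrite lt_min divr_gt0//= divr_gt0.
have t12 : t <= 1 / 2 by rewrite ge_min lexx.
have tC : t * C <= d / 2.
  have : t <= d / (2 * (C + 1)) by rewrite ge_min lexx orbT.
  rewrite ler_pdivlMr// => h; nra.
have td : 0 < t * d / 2 by rewrite divr_gt0// mulr_gt0.
have [_ [s sK ->] Hs] := inf_adherent td A0.
exists s; split => // x Kx.
have I : inf A <= aen e (mix t x s).
  apply: ge_inf; first by case: A0.
  by exists (mix t x s) => //; apply: aprob_mix => //; apply/andP; split; lra.
have EV := HV _ sK; have EL := aen_le _ _ _ e0 sK.
move: I; rewrite aen_mix kap_diag//.
move: Hs EV EL tC; rewrite /C; set E := aen e s; set p := apot e s x; set L := - ln e.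
move=> Hs EV EL tC I.
have key : 2 * (1 - t) * (t * (p - E)) >= - (t * d / 2) - t * (t * (L - E)) by nra.
have h1 : t * (L - E) <= d / 2 by nra.
have h2 : - (t * d) <= 2 * (1 - t) * (t * (p - E)) by nra.
rewrite leNgt; apply/negP => pl.
have n : p - E < - d by lra.
have : t * (p - E) < t * - d by rewrite ltr_pM2l.
nra.
Qed.

End Frostman.

(** * Subharmonic functions *)

Section Subharmonic.
Context {R : realType}.
Local Notation Pl := (R * R)%type.
Local Notation RM := (measurableTypeR R).
Local Notation leb2 := (@lebesgue_measure R \x @lebesgue_measure R)%E.

Lemma has_pd_sqd (p : Pl) :
  has_pd (sqd p) (fun x => 2 * (x.1 - p.1)) (fun x => 2 * (x.2 - p.2)).
Proof.
have H1 := has_pdD _ _ _ _ _ _ has_pd_fst (has_pd_cst (- p.1)).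
have H2 := has_pdD _ _ _ _ _ _ has_pd_snd (has_pd_cst (- p.2)).
have H := has_pdD _ _ _ _ _ _ (has_pdM _ _ _ _ _ _ H1 H1) (has_pdM _ _ _ _ _ _ H2 H2).
have -> : sqd p = (fun x : Pl => (x.1 + - p.1) * (x.1 + - p.1) + (x.2 + - p.2) * (x.2 + - p.2)).
  by apply/funext => x; rewrite /sqd; ring.
by apply: (has_pd_ext _ _ H) => x /=; ring.
Qed.

Lemma smooth_sqd (p : Pl) : smooth (sqd p).
Proof.
by apply: smoothD; apply: smoothM; apply: smoothB;
  (exact: smooth_cst || exact: smooth_fst || exact: smooth_snd).
Qed.

Lemma has_pd_kap (e : R) (p : Pl) : 0 < e ->
  has_pd (kap e p) (fun x => - (x.1 - p.1) / (sqd p x + e ^+ 2))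
    (fun x => - (x.2 - p.2) / (sqd p x + e ^+ 2)).
Proof.
move=> e0; have P x : 0 < sqd p x + e ^+ 2 by exact: sqd_gt0.
have H1 := has_pdD _ _ _ _ _ _ (has_pd_sqd p) (has_pd_cst (e ^+ 2)).
have H2 := has_pdM _ _ _ _ _ _ (has_pd_cst (- 2^-1)) (has_pd_ln _ _ _ H1 P).
have -> : kap e p = (fun x => - 2^-1 * ln (sqd p x + e ^+ 2)).
  by apply/funext => x; rewrite /kap; ring.
by apply: (has_pd_ext _ _ H2) => x /=; field; rewrite gt_eqF.
Qed.

Lemma smooth_kap (e : R) (p : Pl) : 0 < e -> smooth (kap e p).
Proof.
move=> e0; have -> : kap e p = (fun x => - 2^-1 * ln (sqd p x + e ^+ 2)).
  by apply/funext => x; rewrite /kap; ring.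
apply: smoothM; first exact: smooth_cst.
apply: smooth_ln; last by move=> x; exact: sqd_gt0.
by apply: smoothD; [exact: smooth_sqd|exact: smooth_cst].
Qed.

Definition lap (f : Pl -> R) (x : Pl) : R := pd1 (pd1 f) x + pd2 (pd2 f) x.

Definition subharmonic (f : Pl -> R) := smooth f /\ forall x, 0 <= lap f x.

Lemma subharmonic_cst (c : R) : subharmonic (fun=> c).
Proof.
split; first exact: smooth_cst.
have [E1 E2] := has_pdE _ _ _ (has_pd_cst c).
have [E3 E4] := has_pdE _ _ _ (has_pd_cst (0 : R)).
by move=> x; rewrite /lap E1 E2 E3 E4 addr0.
Qed.

Lemma subharmonicD f g : subharmonic f -> subharmonic g ->
  subharmonic (fun x => f x + g x).
Proof.
move=> [sf lf] [sg lg]; split; first exact: smoothD.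
have [E1 E2] := has_pdE _ _ _ (has_pdD _ _ _ _ _ _ (smooth_pd f sf) (smooth_pd g sg)).
have [E3 _] := has_pdE _ _ _ (has_pdD _ _ _ _ _ _
  (smooth_pd _ (smooth_pd1 f sf)) (smooth_pd _ (smooth_pd1 g sg))).
have [_ E4] := has_pdE _ _ _ (has_pdD _ _ _ _ _ _
  (smooth_pd _ (smooth_pd2 f sf)) (smooth_pd _ (smooth_pd2 g sg))).
move=> x; rewrite /lap E1 E2 E3 E4.
by rewrite addrACA addr_ge0//; [exact: lf|exact: lg].
Qed.

Lemma subharmonicZ (c : R) f : 0 <= c -> subharmonic f -> subharmonic (fun x => c * f x).
Proof.
move=> c0 [sf lf]; split; first by apply: smoothM => //; exact: smooth_cst.
have Z (g : Pl -> R) : smooth g -> pd1 (fun x => c * g x) = (fun x => c * pd1 g x) /\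
    pd2 (fun x => c * g x) = (fun x => c * pd2 g x).
  move=> sg; have [-> ->] := has_pdE _ _ _ (has_pdM _ _ _ _ _ _ (has_pd_cst c) (smooth_pd g sg)).
  by split; apply/funext => x; ring.
have [E1 E2] := Z f sf; have [E3 _] := Z _ (smooth_pd1 f sf); have [_ E4] := Z _ (smooth_pd2 f sf).
by move=> x; rewrite /lap E1 E2 E3 E4 -mulrDr mulr_ge0// lf.
Qed.

Lemma subharmonicN_kap (e : R) (p : Pl) : 0 < e -> subharmonic (fun x => - kap e p x).
Proof.
move=> e0; split; first by apply: smoothN; exact: smooth_kap.
have P x : 0 < sqd p x + e ^+ 2 by exact: sqd_gt0.
have P0 x : sqd p x + e ^+ 2 != 0 by rewrite gt_eqF.
have H := has_pdM _ _ _ _ _ _ (has_pd_cst (-1)) (has_pd_kap e p e0).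
have -> : (fun x => - kap e p x) = (fun x => -1 * kap e p x).
  by apply/funext => x; rewrite mulN1r.
have [E1 E2] := has_pdE _ _ _ H.
have Hi := has_pdV _ _ _ (has_pdD _ _ _ _ _ _ (has_pd_sqd p) (has_pd_cst (e ^+ 2))) P0.
have H1 := has_pdM _ _ _ _ _ _ (has_pdD _ _ _ _ _ _ has_pd_fst (has_pd_cst (- p.1))) Hi.
have H2 := has_pdM _ _ _ _ _ _ (has_pdD _ _ _ _ _ _ has_pd_snd (has_pd_cst (- p.2))) Hi.
(* Regularisation has spread the point mass of the Laplacian at p into this positive density. *)
have L : forall x, lap (fun x => -1 * kap e p x) x = 2 * e ^+ 2 / (sqd p x + e ^+ 2) ^+ 2.
  move=> x; rewrite /lap E1 E2.
  have -> : (fun x => -1 * (- (x.1 - p.1) / (sqd p x + e ^+ 2)) + 0 * kap e p x) =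
      (fun x : Pl => (x.1 + - p.1) * (sqd p x + e ^+ 2)^-1).
    by apply/funext => y; ring.
  have -> : (fun x => -1 * (- (x.2 - p.2) / (sqd p x + e ^+ 2)) + 0 * kap e p x) =
      (fun x : Pl => (x.2 + - p.2) * (sqd p x + e ^+ 2)^-1).
    by apply/funext => y; ring.
  have [-> _] := has_pdE _ _ _ H1; have [_ ->] := has_pdE _ _ _ H2.
  have := P0 x; rewrite /sqd => Px; field; exact: Px.
by move=> x; rewrite L divr_ge0 ?exprn_ge0 ?(ltW (P x))// mulr_ge0// exprn_ge0// ltW.
Qed.

Lemma subharmonic_sum (s : seq (R * Pl)) (F : Pl -> Pl -> R) :
  (forall p, p \in s -> 0 <= p.1) -> (forall y, subharmonic (F y)) ->
  subharmonic (fun x => \sum_(p <- s) p.1 * F p.2 x).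
Proof.
move=> s0 HF; elim: s s0 => [|p s IH] s0.
  have -> : (fun x => \sum_(p <- [::]) p.1 * F p.2 x) = (fun=> 0).
    by apply/funext => x; rewrite big_nil.
  exact: subharmonic_cst.
have -> : (fun x => \sum_(q <- p :: s) q.1 * F q.2 x) =
    (fun x => p.1 * F p.2 x + \sum_(q <- s) q.1 * F q.2 x).
  by apply/funext => x; rewrite big_cons.
apply: subharmonicD.
  by apply: subharmonicZ => //; apply: s0; exact: mem_head.
by apply: IH => q qs; apply: s0; rewrite inE qs orbT.
Qed.

Lemma subharmonic_hconv f : subharmonic f -> subharmonic (fun x => hconv (f x)).
Proof.
move=> [sf lf]; split; first by apply: smooth_comp => // k; exact: Ck1_hconv.
have D (g g' : R -> R) : (forall t : R, is_derive t 1 g (g' t)) ->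
    has_pd (fun x => g (f x)) (fun x => g' (f x) * pd1 f x) (fun x => g' (f x) * pd2 f x).
  by move=> H; apply: has_pd_comp (smooth_pd f sf) _ => x; exact: H.
have [E1 E2] := has_pdE _ _ _ (D _ _ is_derive_hconv).
have H := D _ _ is_derive_hconv'.
have [E3 _] := has_pdE _ _ _ (has_pdM _ _ _ _ _ _ H (smooth_pd _ (smooth_pd1 f sf))).
have [_ E4] := has_pdE _ _ _ (has_pdM _ _ _ _ _ _ H (smooth_pd _ (smooth_pd2 f sf))).
move=> x; rewrite /lap E1 E2 E3 E4.
have -> : forall a b c d p q : R, a * b + c * p * p + (a * d + c * q * q) =
  a * (b + d) + c * (p ^+ 2 + q ^+ 2) by move=> *; ring.
apply: addr_ge0; apply: mulr_ge0; [|exact: lf|exact: gexp_ge0|].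
  by rewrite addr_ge0 ?gexp_ge0.
by rewrite addr_ge0 ?sqr_ge0.
Qed.

(* [|grad (chi W)|^2 = W^2 |grad chi|^2 + div (chi^2 W grad W) - chi^2 W (lap W)],
   and the divergence integrates to zero. *)
Lemma caccioppoli (chi W : Pl -> R) (M : R) : 0 <= M -> smooth chi -> subharmonic W ->
  (forall x, 0 <= W x) ->
  (forall x, ~ square M x -> [/\ chi x = 0, pd1 chi x = 0 & pd2 chi x = 0]) ->
  Rintegral leb2 setT (fun x => pd1 (fun y => chi y * W y) x ^+ 2 +
    pd2 (fun y => chi y * W y) x ^+ 2) <=
  Rintegral leb2 setT (fun x => W x ^+ 2 * (pd1 chi x ^+ 2 + pd2 chi x ^+ 2)).
Proof.
move=> M0 sc [sW lW] W0 c0.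
have sc1 := smooth_pd1 _ sc; have sc2 := smooth_pd2 _ sc.
have sW1 := smooth_pd1 _ sW; have sW2 := smooth_pd2 _ sW.
have sW11 := smooth_pd1 _ sW1; have sW22 := smooth_pd2 _ sW2.
have [E1 E2] := has_pdE _ _ _ (has_pdM _ _ _ _ _ _ (smooth_pd _ sc) (smooth_pd _ sW)).
rewrite E1 E2.
have hcc := has_pdM _ _ _ _ _ _ (smooth_pd _ sc) (smooth_pd _ sc).
have F1 := has_pdM _ _ _ _ _ _ hcc
  (has_pdM _ _ _ _ _ _ (smooth_pd _ sW) (smooth_pd _ sW1)).
have F2 := has_pdM _ _ _ _ _ _ hcc
  (has_pdM _ _ _ _ _ _ (smooth_pd _ sW) (smooth_pd _ sW2)).
set g := (X in Rintegral _ _ X <= _); set a := (X in _ <= Rintegral _ _ X).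
set G1 := (fun x => _) in F1; set G1x := (fun x => _) in F1.
set G2 := (fun x => _) in F2; set G2y := (X in has_pd _ _ X) in F2.
have scont h : smooth h -> continuous h := @smooth_continuous R h.
have cg : continuous g.
  apply: scont; rewrite /g; apply: smoothD; apply: smoothM;
    by apply: smoothD; apply: smoothM.
have ca : continuous a.
  by apply: scont; apply: smoothM; [apply: smoothM|apply: smoothD; apply: smoothM].
have cG1 : continuous G1x.
  by apply: scont; repeat (apply: smoothD || apply: smoothM).
have cG2 : continuous G2y.
  by apply: scont; repeat (apply: smoothD || apply: smoothM).
have zg x : ~ square M x -> g x = 0.
  by move=> /c0[h1 h2 h3]; rewrite /g h1 h2 h3; ring.
have za x : ~ square M x -> a x = 0.
  by move=> /c0[h1 h2 h3]; rewrite /a h2 h3; ring.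
have z1 x : ~ square M x -> G1 x = 0 /\ G1x x = 0.
  by move=> /c0[h1 h2 h3]; rewrite /G1 /G1x h1 h2; split; ring.
have z2 x : ~ square M x -> G2 x = 0 /\ G2y x = 0.
  by move=> /c0[h1 h2 h3]; rewrite /G2 /G2y h1 h3; split; ring.
have I1 := integral_pd1_supp _ _ _ M M0 F1 cG1 z1.
have I2 := integral_pd2_supp _ _ _ M M0 F2 cG2 z2.
have ig := continuous_integrable_supp g M cg zg.
have ia := continuous_integrable_supp a M ca za.
have i1 := continuous_integrable_supp G1x M cG1 (fun x h => (z1 x h).2).
have i2 := continuous_integrable_supp G2y M cG2 (fun x h => (z2 x h).2).
have i12 : leb2.-integrable setT (EFin \o (fun x => G1x x + G2y x)).
  by have := integrableD measurableT i1 i2.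
have ia12 : leb2.-integrable setT (EFin \o (fun x => a x + (G1x x + G2y x))).
  by have := integrableD measurableT ia i12.
apply: (@le_trans _ _ (Rintegral leb2 setT (fun x => a x + (G1x x + G2y x)))).
  apply: le_Rintegral => // x _.
  have := lW x; have := W0 x; rewrite /lap => w0 l0.
  rewrite -subr_ge0.
  have -> : a x + (G1x x + G2y x) - g x =
      (chi x) ^+ 2 * (W x * (pd1 (pd1 W) x + pd2 (pd2 W) x)).
    by rewrite /a /G1x /G2y /g; ring.
  by rewrite mulr_ge0 ?sqr_ge0// mulr_ge0.
by rewrite RintegralD// RintegralD// I1 I2 !addr0.
Qed.

End Subharmonic.

(** * Upper bound on the integral of the potential of a point mass *)

Section Potential.
Context {R : realType}.
Local Notation Pl := (R * R)%type.
Local Notation RM := (measurableTypeR R).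
Local Notation leb2 := (@lebesgue_measure R \x @lebesgue_measure R)%E.

Definition disc_area : R := fine (@unit_disc_area R).

Lemma disc_area_gt0 : 0 < disc_area.
Proof.
have /andP[h1 h2] := @unit_disc_area_fin R.
by rewrite /disc_area fine_gt0// h1 h2.
Qed.

Lemma leb2_odiscE (z : Pl) (s : R) : 0 < s ->
  leb2 (odisc z s) = (s ^+ 2 * disc_area)%:E.
Proof.
move=> s0; rewrite leb2_odisc// /disc_area [RHS]EFinM fineK//.
have /andP[h1 h2] := @unit_disc_area_fin R.
by rewrite ge0_fin_numE// ltW.
Qed.

Lemma integrable_indic_odisc (z : Pl) (s : R) : 0 < s ->
  leb2.-integrable setT (EFin \o (\1_(odisc z s) : RM * RM -> R)).
Proof.
move=> s0; have mD := measurable_odisc z s.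
have -> : EFin \o (\1_(odisc z s) : RM * RM -> R) = (EFin \o cst 1) \_ (odisc z s).
  by apply/funext => x; rewrite patchE /= indicE; case: ifP.
apply/(integrable_mkcond _ mD).
apply: (continuous_integrable_square _ (`|z.1| + `|z.2| + s)) => //.
  exact: cst_continuous.
exact: odisc_square.
Qed.

Lemma Rintegral_indic_odisc (z : Pl) (s : R) : 0 < s ->
  Rintegral leb2 setT (\1_(odisc z s) : RM * RM -> R) = s ^+ 2 * disc_area.
Proof.
move=> s0; rewrite /Rintegral integral_indic//; last exact: measurable_odisc.
by rewrite setIT; exact: (congr1 fine (leb2_odiscE z s s0)).
Qed.

(* Integrating the divergence of [(w - x0) H(v w)], where [v] is the normalised
   kernel with pole [x0] and [H] a smooth convex majorant of the positive part. *)
Lemma integral_potential (x0 : Pl) (e s h : R) (A : set (RM * RM)) (M : R) :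
  0 < e -> 0 < s -> 0 < h -> measurable A -> A `<=` square M ->
  Rintegral leb2 A (fun w => kap e x0 w + ln s) <=
  2^-1 * ((s * expR h) ^+ 2 * disc_area).
Proof.
move=> e0 s0 h0 mA AM.
pose v w := kap e x0 w + ln s.
have hv : has_pd v (fun x => - (x.1 - x0.1) / (sqd x0 x + e ^+ 2))
    (fun x => - (x.2 - x0.2) / (sqd x0 x + e ^+ 2)).
  have H := has_pdD _ _ _ _ _ _ (has_pd_kap e x0 e0) (has_pd_cst (ln s)).
  by apply: (has_pd_ext _ _ H) => x; rewrite addr0.
have sv : smooth v by apply: smoothD; [exact: smooth_kap|exact: smooth_cst].
(* The shift by 1 compensates the loss in [hconv_ge], so [H] dominates the identity. Its support
   then starts at -h, which replaces the disc of radius s by one of radius s exp h. *)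
pose H (t : R) : R := h * hconv (h^-1 * t + 1).
pose H' (t : R) : R := gexp 0 (h^-1 * t + 1) + gexp 1 (h^-1 * t + 1).
have hn : h != 0 by rewrite gt_eqF.
have dH (t : R) : is_derive t 1 H (H' t).
  have d1 : is_derive t 1 (fun t : R => h^-1 * t + 1) h^-1.
    by apply: is_derive_eq; rewrite /GRing.scale/=; ring.
  have d2 := @is_derive1_comp R hconv (fun t => h^-1 * t + 1) t _ _ (is_derive_hconv _) d1.
  rewrite /H; apply: (is_derive_eq (@is_deriveZ _ _ _ _ h _ _ _ d2)).
  by rewrite /GRing.scale/= /H' mulrC -mulrA mulVf// mulr1.
have Hge t : t <= H t.
  have := hconv_ge (h^-1 * t + 1); rewrite addrK -(ler_pM2l h0) mulrA divff// mul1r.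
  by [].
have H0 t : 0 <= H t by rewrite mulr_ge0 ?hconv_ge0// ltW.
pose F w := H (v w).
have hF : has_pd F _ _ := has_pd_comp H H' v _ _ hv (fun x => dH (v x)).
have sF : smooth F.
  apply: smoothM; first exact: smooth_cst.
  apply: smooth_comp; first by move=> k; exact: Ck1_hconv.
  by apply: smoothD; [apply: smoothM => //; exact: smooth_cst|exact: smooth_cst].
have sH' : smooth (fun w => H' (v w)).
  have sa : smooth (fun w => h^-1 * v w + 1).
    by apply: smoothD; [apply: smoothM => //; exact: smooth_cst|exact: smooth_cst].
  by apply: smoothD; (apply: smooth_comp => // k; exact: Ck1_gexp).
pose r := s * expR h.
have r0 : 0 < r by rewrite mulr_gt0 ?expR_gt0.
have supp w : ~ odisc x0 r w -> h^-1 * v w + 1 <= 0.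
  move=> nw; have : r ^+ 2 <= sqd x0 w.
    rewrite leNgt; apply/negP => lt; apply: nw.
    by rewrite /odisc /= cdist_lt//; move: lt; rewrite sqdC /sqd.
  move=> rw; have P := sqd_gt0 e x0 w e0.
  have : ln (r ^+ 2) <= ln (sqd x0 w + e ^+ 2).
    by rewrite ler_ln ?posrE ?exprn_gt0//; apply: le_trans rw _; rewrite lerDl sqr_ge0.
  rewrite lnXn// /r lnM ?posrE ?expR_gt0// expRK mulr2n => k1.
  have : v w <= - h by rewrite /v /kap; lra.
  by move=> vh; rewrite -(ler_pM2l h0) mulrDr mulrA divff// mul1r mulr1 mulr0; lra.
pose N := `|x0.1| + `|x0.2| + r.
have N0 : 0 <= N by rewrite !addr_ge0// ltW.
have out w : ~ square N w -> F w = 0 /\ H' (v w) = 0.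
  move=> nw; have /supp h1 : ~ odisc x0 r w by move=> /(odisc_square _ _ r0).
  by rewrite /F /H /H' hconv0// !gexp0// mulr0 addr0.
have G1 := has_pdM _ _ _ _ _ _ (has_pdD _ _ _ _ _ _ has_pd_fst (has_pd_cst (- x0.1))) hF.
have G2 := has_pdM _ _ _ _ _ _ (has_pdD _ _ _ _ _ _ has_pd_snd (has_pd_cst (- x0.2))) hF.
set g1 := (fun x => _) in G1; set g1x := (fun x => _) in G1.
set g2 := (fun x => _) in G2; set g2y := (X in has_pd _ _ X) in G2.
have P0 w : sqd x0 w + e ^+ 2 != 0 by rewrite gt_eqF// sqd_gt0.
have sV : smooth (fun w => (sqd x0 w + e ^+ 2)^-1).
  by apply: smoothV => //; apply: smoothD; [exact: smooth_sqd|exact: smooth_cst].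
have s1 : smooth (fun w : Pl => w.1 - x0.1) by apply: smoothB; [exact: smooth_fst|exact: smooth_cst].
have s2 : smooth (fun w : Pl => w.2 - x0.2) by apply: smoothB; [exact: smooth_snd|exact: smooth_cst].
have cg1 : continuous g1x.
  apply: smooth_continuous; apply: smoothD.
    by apply: smoothM => //; apply: smoothM => //; apply: smoothM => //; exact: smoothN.
  by apply: smoothM => //; apply: smoothD; exact: smooth_cst.
have cg2 : continuous g2y.
  apply: smooth_continuous; apply: smoothD.
    by apply: smoothM => //; apply: smoothM => //; apply: smoothM => //; exact: smoothN.
  by apply: smoothM => //; apply: smoothD; exact: smooth_cst.
have z1 x : ~ square N x -> g1 x = 0 /\ g1x x = 0.
  by move=> /out[h1 h2]; rewrite /g1 /g1x h1 h2; split; ring.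
have z2 x : ~ square N x -> g2 x = 0 /\ g2y x = 0.
  by move=> /out[h1 h2]; rewrite /g2 /g2y h1 h2; split; ring.
have I1 := integral_pd1_supp _ _ _ N N0 G1 cg1 z1.
have I2 := integral_pd2_supp _ _ _ N N0 G2 cg2 z2.
have i1 := continuous_integrable_supp g1x N cg1 (fun x h => (z1 x h).2).
have i2 := continuous_integrable_supp g2y N cg2 (fun x h => (z2 x h).2).
have iF := continuous_integrable_supp F N (smooth_continuous _ sF) (fun x h => (out x h).1).
have ii := integrable_indic_odisc x0 r r0.
pose hind w : R := 2^-1 * (\1_(odisc x0 r) : RM * RM -> R) w.
pose gg w : R := 2^-1 * (g1x w + g2y w).
have i12 : leb2.-integrable setT (EFin \o (fun x => g1x x + g2y x)).
  by have := integrableD measurableT i1 i2.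
have ih : leb2.-integrable setT (EFin \o hind).
  by have := integrableZl measurableT 2^-1 ii.
have igg : leb2.-integrable setT (EFin \o gg).
  by have := integrableZl measurableT 2^-1 i12.
have IF : Rintegral leb2 setT F <= 2^-1 * (r ^+ 2 * disc_area).
  have IB : leb2.-integrable setT (EFin \o (fun w => hind w + gg w)).
    by have := integrableD measurableT ih igg.
  apply: (@le_trans _ _ (Rintegral leb2 setT (fun w => hind w + gg w))).
    apply: le_Rintegral => // w _.
    have Pw := P0 w; have Pw0 := sqd_gt0 e x0 w e0.
    (* Half the divergence of (w - x0) F. The subtracted term is at most 1/2, and 0 off the disc:
       this is the origin of the 1/2 and so of the threshold exp (-1/2). *)
    have E : gg w = F w - 2^-1 * (H' (v w) * (sqd x0 w / (sqd x0 w + e ^+ 2))).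
      by rewrite /gg /g1x /g2y; move: Pw; rewrite /sqd => Pw; field; exact: Pw.
    rewrite E addrCA lerDl subr_ge0 /hind ler_pM2l ?invr_gt0//.
    have H'0 : 0 <= H' (v w) by rewrite addr_ge0 ?gexp_ge0.
    have q1 : sqd x0 w / (sqd x0 w + e ^+ 2) <= 1.
      by rewrite ler_pdivrMr// mul1r lerDl sqr_ge0.
    have q0 : 0 <= sqd x0 w / (sqd x0 w + e ^+ 2).
      by rewrite divr_ge0 ?sqd_ge0// ltW.
    rewrite indicE; case: (boolP (w \in _)) => wD.
      by apply: mulr_ile1 => //; exact: hconv'_le1.
    move: wD; rewrite notin_setE => /supp h1.
    by rewrite /H' !gexp0// addr0 mul0r.
  have -> : Rintegral leb2 setT (fun w => hind w + gg w) =
      Rintegral leb2 setT hind + Rintegral leb2 setT gg by exact: RintegralD.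
  have -> : Rintegral leb2 setT gg =
      2^-1 * Rintegral leb2 setT (fun w => g1x w + g2y w) by exact: RintegralZl.
  have -> : Rintegral leb2 setT (fun w => g1x w + g2y w) =
      Rintegral leb2 setT g1x + Rintegral leb2 setT g2y by exact: RintegralD.
  have -> : Rintegral leb2 setT hind = 2^-1 * Rintegral leb2 setT
      (\1_(odisc x0 r) : RM * RM -> R) by exact: RintegralZl.
  by rewrite I1 I2 addr0 mulr0 addr0 Rintegral_indic_odisc.
apply: le_trans IF; rewrite Rintegral_mkcond; apply: le_Rintegral => //.
- have iv := continuous_integrable_square v M A (smooth_continuous _ sv) mA AM.
  have -> : EFin \o (v \_ A) = ((EFin \o v) \_ A) by rewrite restrict_EFin.
  exact/(integrable_mkcond _ mA).
- by move=> w _; rewrite patchE; case: ifP => _; [exact: Hge|exact: H0].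
Qed.

End Potential.

(** * The test function *)

Section TestFunction.
Context {R : realType}.
Local Notation Pl := (R * R)%type.
Local Notation RM := (measurableTypeR R).
Local Notation leb2 := (@lebesgue_measure R \x @lebesgue_measure R)%E.

Lemma odiscE (z w : Pl) (s : R) : 0 < s -> odisc z s w <-> sqd z w < s ^+ 2.
Proof. by move=> s0; rewrite /odisc /= cdist_lt// sqdC /sqd. Qed.

Lemma closure_odisc (z x : Pl) (s : R) : 0 < s -> closure (odisc z s) x -> sqd z x <= s ^+ 2.
Proof.
move=> s0; have cl : closed [set w | sqd z w <= s ^+ 2].
  apply: (@closed_comp _ _ (sqd z) [set t | t <= s ^+ 2]); last exact: closed_le.
  by move=> w _; apply: smooth_continuous; exact: smooth_sqd.
have E := iffLR (closure_id _) cl.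
move=> h; have : closure [set w | sqd z w <= s ^+ 2] x.
  by apply: closureS h => w /(odiscE _ _ _ s0) /ltW.
by rewrite -E.
Qed.

Lemma closure_odisc_square (z x : Pl) (s : R) : 0 < s -> closure (odisc z s) x ->
  square (`|z.1| + `|z.2| + 2 * s) x.
Proof.
move=> s0 /(closure_odisc _ _ _ s0) h; apply: odisc_square; first lra.
by apply/odiscE; [lra|nra].
Qed.

Context (O : set Pl) (z : Pl) (s e L d eta beta : R) (S : seq (R * Pl)).
Context (oO : open O) (s0 : 0 < s) (e0 : 0 < e) (es : e <= s).
Context (SP : aprob (closure (odisc z s)) S).
Context (d0 : 0 < d) (eta0 : 0 < eta) (b0 : 0 < beta) (b1 : beta < 1) (L0 : 0 < L).
Context (SK : forall x, (closure (odisc z s) `\` O) x -> L - ln s - 2 * d <= apot e S x).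

(** Taking 3d against the 2d of [SK] makes this at most -d on the part of the closed disc outside O,
    which keeps the closed support of the test function inside O. *)
Definition tf_u (x : Pl) : R := (L - 3 * d - ln s) + \sum_(p <- S) p.1 * - kap e p.2 x.
Definition tf_W (x : Pl) : R := hconv (eta^-1 * tf_u x).
(** The standard bump exp (-1 / (1 - |x - z|^2 / s^2)) on the disc. *)
Definition tf_chi (x : Pl) : R := gexp 0 (1 - s ^- 2 * sqd z x).
Definition tf_phi (x : Pl) : R := tf_chi x * tf_W x.

Lemma tf_uE x : tf_u x = L - 3 * d - \sum_(p <- S) p.1 * (kap e p.2 x + ln s).
Proof.
rewrite /tf_u; under [in RHS]eq_bigr do rewrite mulrDr.
rewrite big_split /= -mulr_suml SP.2 mul1r.
have -> : \sum_(p <- S) p.1 * - kap e p.2 x = - \sum_(p <- S) p.1 * kap e p.2 x.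
  by rewrite -sumrN; apply: eq_bigr => p _; rewrite mulrN.
by ring.
Qed.

Lemma tf_u_subharmonic : subharmonic tf_u.
Proof.
apply: subharmonicD; first exact: subharmonic_cst.
apply: (subharmonic_sum S (fun y x => - kap e y x)).
  by move=> p /SP.1[].
by move=> y; exact: subharmonicN_kap.
Qed.

Lemma tf_W_subharmonic : subharmonic tf_W.
Proof.
apply: subharmonic_hconv; apply: subharmonicZ; last exact: tf_u_subharmonic.
by rewrite invr_ge0 ltW.
Qed.

Lemma tf_W_ge0 x : 0 <= tf_W x. Proof. exact: hconv_ge0. Qed.

Lemma tf_chi_pd : has_pd tf_chi
  (fun x => gexp 2 (1 - s ^- 2 * sqd z x) * (- s ^- 2 * (2 * (x.1 - z.1))))
  (fun x => gexp 2 (1 - s ^- 2 * sqd z x) * (- s ^- 2 * (2 * (x.2 - z.2)))).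
Proof.
have H := has_pdD _ _ _ _ _ _ (has_pd_cst 1)
  (has_pdM _ _ _ _ _ _ (has_pd_cst (- s ^- 2)) (has_pd_sqd z)).
have -> : tf_chi = (fun x => gexp 0 (1 + - s ^- 2 * sqd z x)).
  by apply/funext => x; rewrite /tf_chi mulNr.
have dg (t : R) : is_derive t 1 (gexp 0) (gexp 2 t).
  by apply: (is_derive_eq (is_derive_gexp 0 t)); rewrite mulr0n oppr0 mul0r add0r.
have HC := has_pd_comp (gexp 0) (gexp 2) _ _ _ H (fun x => dg _).
by apply: (has_pd_ext _ _ HC) => x /=; rewrite mulNr; ring.
Qed.

Lemma smooth_tf_chi : smooth tf_chi.
Proof.
apply: smooth_comp; first by move=> k; exact: Ck1_gexp.
by apply: smoothB; [exact: smooth_cst|apply: smoothM; [exact: smooth_cst|exact: smooth_sqd]].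
Qed.

Lemma smooth_tf_phi : smooth tf_phi.
Proof. by apply: smoothM; [exact: smooth_tf_chi|exact: tf_W_subharmonic.1]. Qed.

Lemma sqr_radius_gt0 : 0 < s ^+ 2. Proof. by rewrite exprn_gt0. Qed.

Lemma tf_chi_out x : ~ odisc z s x ->
  [/\ tf_chi x = 0, pd1 tf_chi x = 0 & pd2 tf_chi x = 0].
Proof.
move=> nx; have h : 1 - s ^- 2 * sqd z x <= 0.
  rewrite subr_le0 mulrC ler_pdivlMr ?sqr_radius_gt0// mul1r leNgt; apply/negP => lt.
  by apply: nx; apply/odiscE.
have [-> ->] := has_pdE _ _ _ tf_chi_pd.
by rewrite /tf_chi !gexp0// !mul0r.
Qed.

(** In the 16, one factor 4 is the square of the bound 2 on [gexp 2]; the other comes from the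
    squared gradient of the squared distance, which is 4 |x - z|^2. *)
Lemma tf_grad_chi x : pd1 tf_chi x ^+ 2 + pd2 tf_chi x ^+ 2 <=
  16 / s ^+ 2 * (\1_(odisc z s) : RM * RM -> R) x.
Proof.
rewrite indicE; case: (boolP (x \in _)) => [|]; last first.
  by rewrite notin_setE => /tf_chi_out[_ -> ->]; rewrite expr0n/= addr0 mulr0.
rewrite inE => /(odiscE _ _ _ s0) h; rewrite mulr1.
have [-> ->] := has_pdE _ _ _ tf_chi_pd.
set G := gexp 2 _.
have -> : (G * (- s ^- 2 * (2 * (x.1 - z.1)))) ^+ 2 + (G * (- s ^- 2 * (2 * (x.2 - z.2)))) ^+ 2
    = G ^+ 2 * (4 * (sqd z x / s ^+ 2)) / s ^+ 2.
  by rewrite /sqd; field; rewrite gt_eqF.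
rewrite ler_pM2r ?invr_gt0 ?sqr_radius_gt0//.
have q : sqd z x / s ^+ 2 <= 1 by rewrite ler_pdivrMr ?sqr_radius_gt0// mul1r ltW.
have q0 : 0 <= sqd z x / s ^+ 2 by rewrite divr_ge0 ?sqd_ge0// ltW// sqr_radius_gt0.
have G0 : 0 <= G by exact: gexp_ge0.
have G2 : G <= 2 by exact: gexp2_le.
have GG : G ^+ 2 <= 4 by nra.
have GG0 : 0 <= G ^+ 2 by exact: sqr_ge0.
by nra.
Qed.

(** Both points lie in the closed disc and e <= s, so |p - x|^2 + e^2 <= 5 s^2; the 2 bounds (ln 5)
    / 2 through ln (1 + 4) <= 4. *)
Lemma tf_u_le x : odisc z s x -> tf_u x <= L + 2.
Proof.
move=> /(odiscE _ _ _ s0) h; rewrite tf_uE.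
suff : - 2 <= \sum_(p <- S) p.1 * (kap e p.2 x + ln s) by have := d0; lra.
have -> : - 2 = \sum_(p <- S) p.1 * (- 2) :> R by rewrite -mulr_suml SP.2 mul1r.
rewrite big_seq [leRHS]big_seq; apply: ler_sum => p pS.
have [p0 /(closure_odisc _ _ _ s0) hp] := SP.1 _ pS.
apply: ler_wpM2l => //.
have D : sqd p.2 x <= 2 * sqd z p.2 + 2 * sqd z x.
  have t (a b c : R) : (b - c) ^+ 2 <= 2 * (a - b) ^+ 2 + 2 * (a - c) ^+ 2.
    have -> : (b - c) = (a - c) - (a - b) by ring.
    by have := sqr_ge0 ((a - c) + (a - b)); nra.
  by have := t z.1 p.2.1 x.1; have := t z.2 p.2.2 x.2; rewrite /sqd; lra.
have B : sqd p.2 x + e ^+ 2 <= 5 * s ^+ 2.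
  have : e ^+ 2 <= s ^+ 2 by rewrite ler_sqr ?nnegrE// ltW.
  by lra.
have := kap_ge e _ p.2 x e0 B.
rewrite lnM ?posrE ?sqr_radius_gt0// lnXn// mulr2n.
have : ln (1 + 4 : R) <= 4 by apply: le_ln1Dx; lra.
have -> : 1 + 4 = 5 :> R by lra.
by lra.
Qed.

Lemma tf_W_le x : odisc z s x -> tf_W x <= eta^-1 * (L + 2).
Proof.
move=> /tf_u_le h; apply: hconv_le.
  by rewrite mulr_ge0// ?invr_ge0 ?(ltW eta0)//; have := L0; lra.
by rewrite ler_pM2l ?invr_gt0.
Qed.

Lemma tf_u_K x : closure (odisc z s) x -> ~ O x -> tf_u x < 0.
Proof.
move=> cx nO; have /SK : (closure (odisc z s) `\` O) x by split.
rewrite /tf_u; have -> : \sum_(p <- S) p.1 * - kap e p.2 x = - apot e S x.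
  by rewrite /apot -sumrN; apply: eq_bigr => p _; rewrite mulrN.
by have := d0; lra.
Qed.

Lemma tf_W_out x : tf_u x < 0 -> [/\ tf_W x = 0, pd1 tf_W x = 0 & pd2 tf_W x = 0].
Proof.
move=> u0; have h : eta^-1 * tf_u x <= 0.
  by rewrite pmulr_rle0 ?invr_gt0// ltW.
have su : smooth (fun x => eta^-1 * tf_u x).
  by apply: smoothM; [exact: smooth_cst|exact: tf_u_subharmonic.1].
have [-> ->] := has_pdE _ _ _ (has_pd_comp hconv (fun t => gexp 0 t + gexp 1 t) _ _ _
  (smooth_pd _ su) (fun x => is_derive_hconv _)).
by rewrite /tf_W hconv0// !gexp0// addr0 !mul0r.
Qed.

Lemma tf_phi_out x : ~ O x ->
  [/\ tf_phi x = 0, pd1 tf_phi x = 0 & pd2 tf_phi x = 0].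
Proof.
move=> nO.
have [-> ->] := has_pdE _ _ _ (has_pdM _ _ _ _ _ _ (smooth_pd _ smooth_tf_chi)
  (smooth_pd _ tf_W_subharmonic.1)).
have [Dx|/tf_chi_out[h1 h2 h3]] := pselect (odisc z s x).
  have /tf_W_out[h1 h2 h3] : tf_u x < 0 by apply: tf_u_K => //; exact: subset_closure.
  split; first by rewrite /tf_phi h1 mulr0.
    by rewrite h1 mulr0 addr0 h2 mulr0.
  by rewrite h1 mulr0 addr0 h3 mulr0.
split; first by rewrite /tf_phi h1 mul0r.
  by rewrite h1 mul0r add0r h2 mul0r.
by rewrite h1 mul0r add0r h3 mul0r.
Qed.

Definition tf (x : Pl) : Pl := (tf_phi x, 0).

Lemma tf_test_fun : test_fun O tf.
Proof.
(* A closed set containing all points where [tf] is nonzero, and contained in O because [tf_u] is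
   negative on the rest of the closed disc. *)
pose C := closure (odisc z s) `&` [set x | 0 <= tf_u x].
have clC : closed C.
  apply: closedI; first exact: closed_closure.
  apply: (@closed_comp _ _ tf_u [set t | 0 <= t]); last exact: closed_ge.
  by move=> w _; apply: smooth_continuous; exact: tf_u_subharmonic.1.
have sub : closure [set x | tf x <> (0, 0)] `<=` C.
  rewrite [X in _ `<=` X](iffLR (closure_id C) clC); apply: closureS => x /= nx; split.
    apply: subset_closure; apply: contrapT => /tf_chi_out[h _ _]; apply: nx.
    by rewrite /tf /tf_phi h mul0r.
  rewrite /= leNgt; apply/negP => /tf_W_out[h _ _]; apply: nx.
  by rewrite /tf /tf_phi h mulr0.
split; [exact: smooth_tf_phi|split; [exact: smooth_cst|split]].
- apply: (@subclosed_compact _ _ (square (`|z.1| + `|z.2| + 2 * s))).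
  + exact: closed_closure.
  + exact: square_compact.
  + by move=> x /sub[cx _]; exact: closure_odisc_square.
- move=> x /sub[cx u0]; apply: contrapT => nO.
  by have := tf_u_K x cx nO; rewrite ltNge; move: u0 => /= ->.
Qed.

Lemma tf_grad_sq x : grad_sq tf x = pd1 tf_phi x ^+ 2 + pd2 tf_phi x ^+ 2.
Proof.
have [E1 E2] := has_pdE _ _ _ (has_pd_cst (0 : R)).
by rewrite /grad_sq /= E1 E2 expr0n/= !addr0.
Qed.

Lemma tf_abs_sq x : abs_sq tf x = tf_phi x ^+ 2.
Proof. by rewrite /abs_sq /= expr0n/= addr0. Qed.

Lemma Rintegral_full (f : Pl -> R) : (forall x, ~ O x -> f x = 0) ->
  Rintegral leb2 O f = Rintegral leb2 setT f.
Proof.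
move=> f0; rewrite Rintegral_mkcond; apply: eq_Rintegral => x _.
by rewrite patchE; case: ifPn => //; rewrite notin_setE => /f0.
Qed.

Lemma tf_num : Rintegral leb2 O (grad_sq tf) <=
  (eta^-1 * (L + 2)) ^+ 2 * 16 * disc_area.
Proof.
rewrite Rintegral_full; last first.
  by move=> x /tf_phi_out[_ h1 h2]; rewrite tf_grad_sq h1 h2 expr0n/= addr0.
have -> : grad_sq tf = (fun x => pd1 tf_phi x ^+ 2 + pd2 tf_phi x ^+ 2).
  by apply/funext => x; exact: tf_grad_sq.
pose M := `|z.1| + `|z.2| + s.
have M0 : 0 <= M by rewrite !addr_ge0// ltW.
have out x : ~ square M x -> [/\ tf_chi x = 0, pd1 tf_chi x = 0 & pd2 tf_chi x = 0].
  by move=> nx; apply: tf_chi_out => /(odisc_square _ _ s0).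
have H := caccioppoli tf_chi tf_W M M0 smooth_tf_chi tf_W_subharmonic tf_W_ge0 out.
apply: (le_trans H).
set m := eta^-1 * (L + 2).
pose c := m ^+ 2 * (16 / s ^+ 2).
have -> : m ^+ 2 * 16 * disc_area = c * (s ^+ 2 * disc_area).
  by rewrite /c; field; rewrite gt_eqF.
rewrite -(Rintegral_indic_odisc z s s0).
have ii := integrable_indic_odisc z s s0.
have -> : c * Rintegral leb2 setT (\1_(odisc z s) : RM * RM -> R) =
    Rintegral leb2 setT (fun x => c * (\1_(odisc z s) : RM * RM -> R) x).
  by apply: esym; exact: RintegralZl.
have sW := tf_W_subharmonic.1; have sc := smooth_tf_chi.
have sc1 := smooth_pd1 _ sc; have sc2 := smooth_pd2 _ sc.
apply: le_Rintegral => //.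
- apply: (continuous_integrable_supp _ M).
    apply: smooth_continuous.
    by apply: smoothM; [apply: smoothM|apply: smoothD; apply: smoothM].
  by move=> x /out[_ -> ->]; rewrite expr0n/= addr0 mulr0.
- by have := integrableZl measurableT c ii.
- move=> x _; have g := tf_grad_chi x.
  have [Dx|/tf_chi_out[_ h1 h2]] := pselect (odisc z s x); last first.
    rewrite h1 h2 expr0n/= addr0 mulr0; apply: mulr_ge0; last by rewrite indicE ler0n.
    by rewrite /c mulr_ge0 ?sqr_ge0// divr_ge0// ltW// sqr_radius_gt0.
  rewrite /c -mulrA; apply: ler_pM => //.
  + exact: sqr_ge0.
  + by rewrite addr_ge0 ?sqr_ge0.
  + rewrite ler_sqr ?nnegrE ?tf_W_ge0 ?tf_W_le//.
    by apply: le_trans (tf_W_le x Dx); exact: tf_W_ge0.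
Qed.

Lemma integral_potential_sum (T : seq (R * Pl)) (A : set (RM * RM)) (M h : R) :
  (forall p, p \in T -> 0 <= p.1) -> 0 < h -> measurable A -> A `<=` square M ->
  Rintegral leb2 A (fun w => \sum_(p <- T) p.1 * (kap e p.2 w + ln s)) <=
  (\sum_(p <- T) p.1) * (2^-1 * ((s * expR h) ^+ 2 * disc_area)).
Proof.
move=> T0 h0 mA AM; elim: T T0 => [|p T IH] T0.
  have -> : (fun w => \sum_(p <- [::]) p.1 * (kap e p.2 w + ln s)) = (fun=> 0).
    by apply/funext => w; rewrite big_nil.
  by rewrite big_nil mul0r /Rintegral integral0.
have -> : (fun w => \sum_(q <- p :: T) q.1 * (kap e q.2 w + ln s)) =
    (fun w => p.1 * (kap e p.2 w + ln s) + \sum_(q <- T) q.1 * (kap e q.2 w + ln s)).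
  by apply/funext => w; rewrite big_cons.
have sk q : smooth (fun w => kap e q w + ln s).
  by apply: smoothD; [exact: smooth_kap|exact: smooth_cst].
have i0 := continuous_integrable_square _ M A (smooth_continuous _ (sk p.2)) mA AM.
have i1 : leb2.-integrable A (EFin \o (fun w => p.1 * (kap e p.2 w + ln s))).
  by have := integrableZl mA p.1 i0.
have i2 : leb2.-integrable A (EFin \o (fun w => \sum_(q <- T) q.1 * (kap e q.2 w + ln s))).
  apply: (continuous_integrable_square _ M) => //; apply: smooth_continuous.
  by apply: smooth_sum => q; apply: smoothM => //; exact: smooth_cst.
rewrite RintegralD// big_cons mulrDl; apply: lerD; last first.
  by apply: IH => q qT; apply: T0; rewrite inE qT orbT.
rewrite RintegralZl//; apply: ler_wpM2l; first by apply: T0; exact: mem_head.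
exact: (integral_potential p.2 e s h A M).
Qed.

(** A lower bound for the integral of [tf_u - eta] over the concentric disc of area fraction beta,
    in units of the area of the full disc. It tends to L - 1/2 as d and eta tend to 0 and beta to 1.
    The smaller disc is needed because the cutoff vanishes at the boundary of the full one. *)
Definition tf_gap : R := (L - 3 * d - eta) * beta - (2 * beta)^-1.
Definition tf_cchi : R := gexp 0 (1 - beta).
(** On the smaller disc the cutoff is at least [tf_cchi], so this bounds below the integral of
    [tf_phi] there, again in units of the full area. *)
Definition tf_c : R := tf_cchi * (eta^-1 * tf_gap).

Let inner_radius := s * Num.sqrt beta.

Lemma inner_radius_gt0 : 0 < inner_radius. Proof. by rewrite mulr_gt0// sqrtr_gt0. Qed.

Lemma inner_radius_sqr : inner_radius ^+ 2 = beta * s ^+ 2.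
Proof. by rewrite /inner_radius exprMn sqr_sqrtr ?ltW// mulrC. Qed.

Lemma tf_mean : tf_gap * (s ^+ 2 * disc_area) <=
  Rintegral leb2 (odisc z inner_radius) (fun x => tf_u x - eta).
Proof.
have mD := measurable_odisc z inner_radius.
have DM := odisc_square z inner_radius inner_radius_gt0.
(* Chosen so that exp (2h) = 1 / beta, which makes the smoothing error another power of beta. *)
pose h := - ln beta / 2.
have lb : ln beta < 0 by rewrite ln_lt0// b0.
have h0 : 0 < h by rewrite /h; lra.
have eh : (s * expR h) ^+ 2 = s ^+ 2 / beta.
  rewrite exprMn -expRM_natl /h (_ : 2%:R * (- ln beta / 2) = - ln beta); last by field.
  by rewrite expRN lnK// posrE.
have P := integral_potential_sum S (odisc z inner_radius) _ h (fun p pS => (SP.1 p pS).1) h0 mD DM.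
rewrite SP.2 mul1r eh in P.
pose f w := \sum_(p <- S) p.1 * (kap e p.2 w + ln s).
have sf : smooth f.
  apply: smooth_sum => q; apply: smoothM; first exact: smooth_cst.
  by apply: smoothD; [exact: smooth_kap|exact: smooth_cst].
pose k := L - 3 * d - eta.
have -> : (fun x => tf_u x - eta) = (fun x => k - f x).
  by apply/funext => x; rewrite tf_uE /k /f; ring.
have if_ := continuous_integrable_square _ _ _ (smooth_continuous _ sf) mD DM.
have ik : leb2.-integrable (odisc z inner_radius) (EFin \o (fun=> k)).
  by apply: (continuous_integrable_square _ _ _ _ mD DM); exact: cst_continuous.
have -> : Rintegral leb2 (odisc z inner_radius) (fun x => k - f x) =
    Rintegral leb2 (odisc z inner_radius) (fun=> k) - Rintegral leb2 (odisc z inner_radius) f.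
  exact: RintegralB.
have -> : Rintegral leb2 (odisc z inner_radius) (fun=> k) = k * (inner_radius ^+ 2 * disc_area).
  rewrite Rintegral_cst//; congr (_ * _).
  exact: (congr1 fine (leb2_odiscE z inner_radius inner_radius_gt0)).
rewrite inner_radius_sqr /tf_gap -/k.
have -> : (k * beta - (2 * beta)^-1) * (s ^+ 2 * disc_area) =
   k * (beta * s ^+ 2 * disc_area) - 2^-1 * (s ^+ 2 / beta * disc_area).
  by field; rewrite gt_eqF.
by rewrite lerB.
Qed.

(** The tangent line inequality phi^2 >= 2 c phi - c^2 with c = [tf_c]. Integrated, it plays the
    part of Cauchy-Schwarz and reduces the L^2 bound to the mean of u. *)
Lemma tf_phi_ge x : odisc z inner_radius x -> 0 < tf_gap ->
  2 * tf_c * (tf_cchi * eta^-1) * (tf_u x - eta) - tf_c ^+ 2 <= tf_phi x ^+ 2.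
Proof.
move=> /(odiscE _ _ _ inner_radius_gt0); rewrite inner_radius_sqr => h gap0.
have c1 : tf_cchi <= tf_chi x.
  rewrite /tf_cchi /tf_chi.
  have y : 1 - beta <= 1 - s ^- 2 * sqd z x.
    by rewrite lerD2l lerN2 mulrC ler_pdivrMr ?sqr_radius_gt0// ltW.
  have y0 : 0 < 1 - beta by have := b1; lra.
  rewrite !gexpE//; last exact: lt_le_trans y.
  rewrite !expr0 !mul1r ler_expR lerN2 lef_pV2 ?posrE//; exact: lt_le_trans y.
have c0 : 0 <= tf_cchi by exact: gexp_ge0.
have cc : 0 <= tf_c by rewrite mulr_ge0// mulr_ge0 ?invr_ge0 ?(ltW gap0)// ltW.
have w : eta^-1 * (tf_u x - eta) <= tf_W x.
  have := hconv_ge (eta^-1 * tf_u x); rewrite -/(tf_W x).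
  by rewrite mulrBr mulVf// gt_eqF.
have ph : tf_cchi * (eta^-1 * (tf_u x - eta)) <= tf_phi x.
  apply: (@le_trans _ _ (tf_cchi * tf_W x)); first exact: ler_wpM2l.
  by apply: ler_wpM2r => //; exact: tf_W_ge0.
have := sqr_ge0 (tf_phi x - tf_c).
have : tf_c * (tf_cchi * (eta^-1 * (tf_u x - eta))) <= tf_c * tf_phi x by exact: ler_wpM2l.
move=> h1 h2.
have -> : 2 * tf_c * (tf_cchi * eta^-1) * (tf_u x - eta) =
  2 * (tf_c * (tf_cchi * (eta^-1 * (tf_u x - eta)))) by ring.
have -> : tf_phi x ^+ 2 = (tf_phi x - tf_c) ^+ 2 + 2 * (tf_c * tf_phi x) - tf_c ^+ 2 by ring.
by lra.
Qed.

Lemma tf_den : 0 < tf_gap ->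
  tf_c ^+ 2 * (s ^+ 2 * disc_area) <= Rintegral leb2 O (abs_sq tf).
Proof.
move=> gap0; rewrite Rintegral_full; last first.
  by move=> x /tf_phi_out[h _ _]; rewrite tf_abs_sq h expr0n.
have -> : abs_sq tf = (fun x => tf_phi x ^+ 2) by apply/funext => x; exact: tf_abs_sq.
have mD := measurable_odisc z inner_radius.
have DM := odisc_square z inner_radius inner_radius_gt0.
have su := tf_u_subharmonic.1.
have sue : smooth (fun x => tf_u x - eta) by apply: smoothB => //; exact: smooth_cst.
have iu := continuous_integrable_square _ _ _ (smooth_continuous _ sue) mD DM.
pose k := 2 * tf_c * (tf_cchi * eta^-1).
have iku : leb2.-integrable (odisc z inner_radius) (EFin \o (fun x => k * (tf_u x - eta))).
  by have := integrableZl mD k iu.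
have ic : leb2.-integrable (odisc z inner_radius) (EFin \o (fun=> tf_c ^+ 2)).
  by apply: (continuous_integrable_square _ _ _ _ mD DM); exact: cst_continuous.
pose f x := k * (tf_u x - eta) - tf_c ^+ 2.
have if_ : leb2.-integrable (odisc z inner_radius) (EFin \o f).
  by have := integrableB mD iku ic.
have c0 : 0 <= tf_cchi by exact: gexp_ge0.
have cc : 0 <= tf_c by rewrite mulr_ge0// mulr_ge0 ?invr_ge0 ?(ltW gap0)// ltW.
have i0 : 0 <= eta^-1 by rewrite invr_ge0 ltW.
have k0 : 0 <= k by apply: mulr_ge0; apply: mulr_ge0.
have E : Rintegral leb2 (odisc z inner_radius) f =
    k * Rintegral leb2 (odisc z inner_radius) (fun x => tf_u x - eta) -
    tf_c ^+ 2 * (beta * s ^+ 2 * disc_area).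
  have -> : Rintegral leb2 (odisc z inner_radius) f = Rintegral leb2 (odisc z inner_radius)
      (fun x => k * (tf_u x - eta)) - Rintegral leb2 (odisc z inner_radius) (fun=> tf_c ^+ 2).
    exact: RintegralB.
  congr (_ - _); first exact: RintegralZl.
  rewrite Rintegral_cst//; congr (_ * _); rewrite -inner_radius_sqr.
  exact: (congr1 fine (leb2_odiscE z inner_radius inner_radius_gt0)).
apply: (@le_trans _ _ (Rintegral leb2 (odisc z inner_radius) f)).
  rewrite E; have := ler_wpM2l k0 tf_mean; set I := Rintegral _ _ _.
  have -> : k * (tf_gap * (s ^+ 2 * disc_area)) = 2 * tf_c ^+ 2 * (s ^+ 2 * disc_area).
    by rewrite /k /tf_c; ring.
  have A0 := disc_area_gt0 (R := R).
  have sA : 0 <= s ^+ 2 * disc_area by rewrite mulr_ge0 ?sqr_ge0// ltW.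
  have : tf_c ^+ 2 * (beta * s ^+ 2 * disc_area) <= tf_c ^+ 2 * (s ^+ 2 * disc_area).
    apply: ler_wpM2l; first exact: sqr_ge0.
    by rewrite -mulrA ler_piMl// ltW.
  by lra.
rewrite Rintegral_mkcond; apply: le_Rintegral => //.
- have -> : EFin \o (f \_ (odisc z inner_radius)) =
      ((EFin \o f) \_ (odisc z inner_radius)) by rewrite restrict_EFin.
  exact/(integrable_mkcond _ mD).
- apply: (continuous_integrable_supp _ (`|z.1| + `|z.2| + s)).
    by apply: smooth_continuous; apply: smoothM; exact: smooth_tf_phi.
  move=> x nx; have [h _ _] : [/\ tf_chi x = 0, pd1 tf_chi x = 0 & pd2 tf_chi x = 0].
    by apply: tf_chi_out => /(odisc_square _ _ s0).
  by rewrite /tf_phi h mul0r expr0n.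
- move=> x _; rewrite patchE; case: ifPn => [|_]; last exact: sqr_ge0.
  by rewrite inE => Dx; exact: tf_phi_ge.
Qed.

Lemma lambda1_le_tf : 0 < tf_gap ->
  (lambda1 O <= ((eta^-1 * (L + 2)) ^+ 2 * 16 / tf_c ^+ 2 / s ^+ 2)%:E)%E.
Proof.
move=> gap0.
have A0 := disc_area_gt0 (R := R).
have c0 : 0 < tf_c.
  rewrite mulr_gt0 ?mulr_gt0 ?invr_gt0//.
  have y0 : 0 < 1 - beta by have := b1; lra.
  by rewrite /tf_cchi gexpE// expr0 mul1r expR_gt0.
have dp : 0 < tf_c ^+ 2 * (s ^+ 2 * disc_area).
  by apply: mulr_gt0; [|apply: mulr_gt0 => //]; rewrite exprn_gt0.
have den := tf_den gap0.
apply: (@le_trans _ _ (rayleigh O tf)%:E).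
  apply: ereal_inf_lbound; exists tf => //; split; first exact: tf_test_fun.
  apply: contrapT => H; have : 0 < Rintegral leb2 O (abs_sq tf) by exact: lt_le_trans den.
  rewrite (_ : abs_sq tf = fun=> 0); first by rewrite /Rintegral integral0 ltxx.
  apply/funext => x; have -> : abs_sq tf x = (tf x).1 ^+ 2 + (tf x).2 ^+ 2 by [].
  have -> : tf x = (0, 0) by apply: contrapT => hx; apply: H; exists x.
  by rewrite /= expr0n/= addr0.
rewrite lee_fin /rayleigh -/(leb2).
have num := tf_num.
have dd : 0 < Rintegral leb2 O (abs_sq tf) by exact: lt_le_trans den.
rewrite ler_pdivrMr//; apply: (le_trans num).
set m := (eta^-1 * (L + 2)) ^+ 2 * 16.
have m0 : 0 <= m by rewrite mulr_ge0// sqr_ge0.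
have -> : m * disc_area = m / tf_c ^+ 2 / s ^+ 2 * (tf_c ^+ 2 * (s ^+ 2 * disc_area)).
  by field; rewrite ?(gt_eqF s0) ?(gt_eqF c0).
by apply: ler_wpM2l den; rewrite !divr_ge0// ?sqr_ge0.
Qed.

End TestFunction.

(** * The bound on the first eigenvalue *)

Section Main.
Context {R : realType}.
Local Notation Pl := (R * R)%type.

Lemma log_cap_le_robin (K : set Pl) (c : R) : 0 < c ->
  (log_cap K <= c%:E)%E -> ((- ln c)%:E <= robin K)%E.
Proof.
move=> c0; rewrite /log_cap -[X in (_ <= X%:E)%E](lnK c0).
have -> : (expR (ln c))%:E = expeR (ln c)%:E by [].
by rewrite lee_expeR EFinN leeNl.
Qed.

Lemma log_cap_set0 : log_cap (set0 : set Pl) = 0%E.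
Proof.
have rob : robin (set0 : set Pl) = +oo%E.
  transitivity (ereal_inf (set0 : set (\bar R))); last exact: ereal_inf0.
  congr (ereal_inf _); apply/seteqP; split => // _ [mu /= h _].
  by move: h; rewrite setC0 probability_setT => /eqP; rewrite eqe oner_eq0.
by rewrite /log_cap rob.
Qed.

Lemma gap_parameters (L : R) : 1 / 2 < L -> exists d eta beta : R,
  [/\ 0 < d, 0 < eta, 0 < beta < 1 &
      0 < (L - 3 * d - eta) * beta - (2 * beta)^-1].
Proof.
(* With 3d + eta = k and beta = 1 / (1 + k'), positivity reads (1 + k')^2 < 2 (L - k) = 1 + 6k. It
   holds because k' <= 1 and k' <= k bound the left side by 1 + 3k. *)
move=> hL; pose k := (L - 1 / 2) / 4; have k0 : 0 < k by rewrite /k; lra.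
pose k' := Num.min k 1.
have k'0 : 0 < k' by rewrite lt_min k0 ltr01.
have k'1 : k' <= 1 by rewrite ge_min lexx orbT.
have k'k : k' <= k by rewrite ge_min lexx.
have q0 : 0 < 1 + k' by lra.
exists (k / 6), (k / 2), (1 + k')^-1; split.
- by rewrite divr_gt0.
- by rewrite divr_gt0.
- by rewrite invr_gt0 q0 invf_lt1//; lra.
- have -> : (L - 3 * (k / 6) - k / 2) * (1 + k')^-1 - (2 * (1 + k')^-1)^-1 =
      ((L - k) * 2 - (1 + k') ^+ 2) / (2 * (1 + k')) by field; rewrite gt_eqF.
  by rewrite divr_gt0//; [rewrite /k in k'k *; nra|lra].
Qed.

Lemma lambda1_le_disc (a : R) : 0 < a < expR (- (1 / 2)) ->
  exists C : R, 0 < C /\ forall (O : set Pl) (z : Pl) (s : R),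
    open O -> 0 < s ->
    (log_cap (closure (odisc z s) `\` O) <= (a * s)%:E)%E ->
    (lambda1 O <= (C / s ^+ 2)%:E)%E.
Proof.
move=> /andP[a0 ae]; pose L := - ln a.
have hL : 1 / 2 < L.
  have : ln a < - (1 / 2) by rewrite -(expRK (- (1 / 2))) ltr_ln ?posrE ?expR_gt0.
  by rewrite /L; lra.
have [d [eta [beta [d0 eta0 /andP[b0 b1] gap]]]] := gap_parameters L hL.
have L0 : 0 < L by lra.
have c0 : 0 < tf_c L d eta beta.
  rewrite /tf_c mulr_gt0 ?mulr_gt0 ?invr_gt0//.
  have y0 : 0 < 1 - beta by lra.
  by rewrite /tf_cchi gexpE// expr0 mul1r expR_gt0.
exists ((eta^-1 * (L + 2)) ^+ 2 * 16 / tf_c L d eta beta ^+ 2); split.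
  rewrite divr_gt0 ?exprn_gt0// mulr_gt0// exprn_gt0// mulr_gt0 ?invr_gt0//; lra.
move=> O z s oO s0 cap.
pose K := closure (odisc z s) `\` O.
have clK : closed K.
  by apply: closedI; [exact: closed_closure|exact: open_closedC].
pose M := `|z.1| + `|z.2| + 2 * s.
have M0 : 0 < M.
  by have := normr_ge0 z.1; have := normr_ge0 z.2; rewrite /M; lra.
have KM x : K x -> `|x.1| <= M /\ `|x.2| <= M.
  by move=> [cx _]; apply/squareP; exact: closure_odisc_square.
have VK : ((L - ln s)%:E <= robin K)%E.
  have := log_cap_le_robin K (a * s) (mulr_gt0 a0 s0) cap.
  by rewrite lnM ?posrE// opprD.
have [e [e0 es He]] := regularised_energy_bound K M (L - ln s) d s M0 KM clK VK d0 s0.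
suff [S [SP SK]] : exists S, aprob (closure (odisc z s)) S /\
    forall x, K x -> L - ln s - 2 * d <= apot e S x.
  have H := lambda1_le_tf O z s e L d eta beta S.
  by apply: H.
have [K0|K0] := pselect (K !=set0).
  have [S [[S0 S1] SK]] := potential_lower K e (L - ln s - d) d e0 d0 K0 He.
  exists S; split.
    by split => // p /S0[? []].
  by move=> x /SK; lra.
(* If the disc lies in O up to closure, there is no measure on K; any probability measure on the
   disc works, and the lower bound on K is vacuous. *)
exists [:: (1, z)]; split; last by move=> x Kx; exfalso; apply: K0; exists x.
split; last by rewrite big_seq1.
move=> p; rewrite inE => /eqP -> /=; split => //; apply: subset_closure.
by apply/odiscE => //; rewrite /sqd !subrr expr0n/= addr0 exprn_gt0.
Qed.

(** The bound is only available at radii strictly below an admissible one, so it reaches the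
    supremum T as a limit. For T = +oo the inverse square is 0, and radii n + 1 give the matching
    bound. *)
Lemma lee_divr_sqr (x : \bar R) (C : R) (A : set R) : 0 < C ->
  (exists r, A r) -> (forall r, A r -> 0 < r) ->
  (forall r s, A r -> 0 < s < r -> (x <= (C / s ^+ 2)%:E)%E) ->
  (x <= C%:E * (ereal_sup [set r%:E | r in A] ^+ 2)^-1)%E.
Proof.
move=> C0 [r0 Ar0] A0 H.
set T := ereal_sup _.
have bnd (s : R) : 0 < s -> (s%:E < T)%E -> (x <= (C / s ^+ 2)%:E)%E.
  move=> s0 /ereal_sup_gt[_ [r Ar <-]]; rewrite lte_fin => sr.
  by apply: (H r) => //; rewrite s0.
have T0 : (0 < T)%E.
  apply: (@lt_le_trans _ _ r0%:E); first by rewrite lte_fin A0.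
  by apply: ereal_sup_ubound; exists r0.
case: T T0 bnd => [t| |] //=.
- rewrite lte_fin => t0 bnd.
  have -> : (C%:E * (t%:E ^+ 2)^-1 = (C / t ^+ 2)%:E)%E.
    rewrite -EFin_expe inver gt_eqF ?exprn_gt0//.
  have cv : (C / (t * (1 - n.+2%:R^-1)) ^+ 2)%:E @[n --> \oo] --> (C / t ^+ 2)%:E.
    apply: cvg_EFin; first exact: nearW.
    apply: cvgM; first exact: cvg_cst.
    apply: cvgV; first by rewrite gt_eqF// exprn_gt0.
    have c1 : (t * (1 - n.+2%:R^-1)) @[n --> \oo] --> t.
      rewrite -[X in _ --> X]mulr1; apply: cvgM; first exact: cvg_cst.
      rewrite -[X in _ --> X]subr0; apply: cvgB; first exact: cvg_cst.
      by have := @cvg_harmonic R; rewrite -cvg_shiftS.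
    exact: (cvgM c1 c1).
  rewrite -(cvg_lim (@ereal_hausdorff R) cv); apply: lime_ge; first exact: (cvgP _ cv).
  apply: nearW => n.
  have n1 : n.+2%:R^-1 < 1 :> R by rewrite invf_lt1 ?ltr0n// ltr1n.
  have n0 : 0 < n.+2%:R^-1 :> R by rewrite invr_gt0 ltr0n.
  apply: bnd; first by rewrite mulr_gt0// subr_gt0.
  by rewrite lte_fin gtr_pMr// gtrBl.
- move=> _ bnd.
  have -> : (C%:E * (+oo ^+ 2)^-1 = 0 :> \bar R)%E.
    by rewrite (_ : +oo ^+ 2 = +oo)%E ?invey ?mule0// expe2 mulyy.
  have cv : (C / n.+1%:R ^+ 2)%:E @[n --> \oo] --> (0 : R)%:E.
    apply: cvg_EFin; first exact: nearW.
    rewrite -[X in _ --> X](mulr0 C); apply: cvgM; first exact: cvg_cst.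
    rewrite -[X in _ --> X](mulr0 0).
    have -> : (fun n => (n.+1%:R ^+ 2)^-1) = (fun n => n.+1%:R^-1 * n.+1%:R^-1 :> R).
      by apply/funext => n; rewrite -invfM.
    by apply: cvgM; exact: cvg_harmonic.
  have E0 := cvg_lim (@ereal_hausdorff R) cv.
  rewrite -[X in (_ <= X)%E]E0; apply: lime_ge; first exact: (cvgP _ cv).
  by apply: nearW => n; apply: bnd; rewrite ?ltr0n ?ltry.
Qed.

End Main.

Theorem theorem7p1 (R : realType) (a : R) :
  0 < a < expR (- (1 / 2)) ->
  exists C : R, 0 < C /\
    forall O : set (R * R)%type,
      open O -> connected O -> O !=set0 -> O != setT ->
      (lambda1 O <= C%:E * (RL O a ^+ 2)^-1)%E.
Proof.
move=> ha; have [C [C0 HC]] := lambda1_le_disc a ha.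
exists C; split => // O oO _ [z Oz] _; have /andP[a0 _] := ha.
apply: lee_divr_sqr => //.
(* Small closed discs lie in O and leave an empty remainder, of capacity 0. Hence some radius is
   admissible and the supremum is positive. *)
- have /nbhs_ballP[r /= r0 Hr] : nbhs z O by exact: open_nbhs_nbhs.
  exists (r / 2); split; first by rewrite divr_gt0.
  exists z; split => // s /andP[s0 sr].
  have -> : closure (odisc z s) `\` O = set0.
    apply/seteqP; split => // x [/(closure_odisc _ _ _ s0) h nO]; apply: nO.
    apply: Hr; rewrite /ball /= /prod_ball /ball /=.
    have q (u v : R) : u ^+ 2 + v ^+ 2 <= s ^+ 2 -> `|u| < r.
      move=> uv; apply: (@le_lt_trans _ _ s); last lra.
      rewrite -(ger0_norm (ltW s0)) -ler_sqr ?nnegrE// !real_normK ?num_real//.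
      by apply: le_trans uv; rewrite lerDl sqr_ge0.
    split; first exact: (q _ _ h).
    by apply: (q _ (z.1 - x.1)); rewrite addrC.
  by rewrite log_cap_set0 lee_fin mulr_ge0// ltW.
- by move=> r [].
- move=> r s [r0 [w [Ow Hw]]] sr.
  by apply: (HC O w s) => //; [case/andP: sr|exact: Hw].
Qed.
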